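(* Let $D$ be a finitely generated abelian group and let $A=\bigoplus_{d\in D}A_d$ be a $D$-graded noetherian normal ring. Then $\operatorname{Proj}_{\mathrm{MH}}A$ is a normal scheme.
   Context: All rings are commutative with $1$. Let $D$ be a finitely generated abelian group. A $D$-graded ring $B$ is periodic if the subgroup $\{d\in D : \exists\, g\in B_d\cap B^\times\}$ has finite index in $D$. A homogeneous element $f$ of a $D$-graded ring $A$ is relevant if the localization $A_f$ (with its induced $D$-grading) is periodic; $A_{(f)}$ denotes the degree $0$ part of $A_f$. The grading corresponds to an action of the diagonalizable group scheme $\operatorname{Spec}A_0[D]$ on $\operatorname{Spec}A$; let $Q$ be the quotient in the category of ringed spaces. For relevant $f$ one has an open subspace $D_+(f)=\operatorname{Spec}A_{(f)}\subset Q$, and $\operatorname{Proj}_{\mathrm{MH}}A=\bigcup_{f\text{ relevant}}D_+(f)\subset Q$, which is a scheme. *)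

(* Defs.v *)
From HB Require Import structures.
From Stdlib Require Import Relation_Operators.
From mathcomp Require Import all_boot all_algebra.
From mathcomp Require Import all_classical finmap topology.
From mathcomp Require Import ring.

Set Implicit Arguments.
Unset Strict Implicit.
Unset Printing Implicit Defensive.

Import GRing.Theory.
Local Open Scope classical_set_scope.
Local Open Scope ring_scope.
Local Open Scope quotient_scope.

Section EquivRelOfProp.
Variables (T : Type) (R : T -> T -> Prop).
Hypotheses (Rrefl : forall x, R x x) (Rsym : forall x y, R x y -> R y x).
Hypothesis Rtrans : forall y x z, R x y -> R y z -> R x z.

Let r (x y : T) := `[< R x y >].

Lemma equivb_refl : reflexive r.
Proof. by move=> x; apply/asboolP. Qed.

Lemma equivb_sym : symmetric r.
Proof. by move=> x y; apply/asboolP/asboolP; exact: Rsym. Qed.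

Lemma equivb_trans : transitive r.
Proof.
by move=> y x z /asboolP h /asboolP h'; apply/asboolP; exact: Rtrans h h'.
Qed.

Definition equivb : equiv_rel T := EquivRel r equivb_refl equivb_sym equivb_trans.

End EquivRelOfProp.

(** Rings are [comPzRingType]s, so that the zero ring is allowed: it occurs as
    a localization and as the ring of sections over the empty set. *)

Definition is_ideal (A : comPzRingType) (I : set A) :=
  [/\ I 0, (forall a b, I a -> I b -> I (a + b))
    & (forall a b, I b -> I (a * b))].

Definition noetherian (A : comPzRingType) := forall I : set A, is_ideal I ->
  exists (n : nat) (g : 'I_n -> A), (forall i, I (g i)) /\
    forall x, I x -> exists c : 'I_n -> A, x = \sum_i c i * g i.

Definition is_prime (A : comPzRingType) (I : set A) :=
  [/\ is_ideal I, ~ I 1 & (forall a b, I (a * b) -> I a \/ I b)].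

Record primeIdeal (A : comPzRingType) :=
  PrimeIdeal { prime_set :> A -> Prop; primeP : is_prime prime_set }.

Lemma prime_eq (A : comPzRingType) (p q : primeIdeal A) :
  prime_set p = prime_set q -> p = q.
Proof.
by case: p q => [p hp] [q hq] /= e; subst; congr PrimeIdeal; exact: Prop_irrelevance.
Qed.

Record mulSet (A : comPzRingType) := MulSet {
  mul_set :> A -> Prop;
  mul_set1 : mul_set 1;
  mul_setM : forall a b, mul_set a -> mul_set b -> mul_set (a * b) }.

Lemma prime_compl1 (A : comPzRingType) (p : primeIdeal A) : (~` p) 1.
Proof. by case: (primeP p). Qed.

Lemma prime_complM (A : comPzRingType) (p : primeIdeal A) (a b : A) :
  (~` p) a -> (~` p) b -> (~` p) (a * b).
Proof. by case: (primeP p) => _ _ h ha hb /h []. Qed.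

Definition prime_compl (A : comPzRingType) (p : primeIdeal A) : mulSet A :=
  MulSet (@prime_compl1 A p) (@prime_complM A p).

Definition powers_set (A : comPzRingType) (f : A) : set A :=
  [set a | exists n, a = f ^+ n].

Lemma powers_set1 (A : comPzRingType) (f : A) : powers_set f 1.
Proof. by exists 0%N. Qed.

Lemma powers_setM (A : comPzRingType) (f a b : A) :
  powers_set f a -> powers_set f b -> powers_set f (a * b).
Proof. by move=> [m ->] [n ->]; exists (m + n)%N; rewrite exprD. Qed.

Definition powers (A : comPzRingType) (f : A) : mulSet A :=
  MulSet (powers_set1 f) (@powers_setM A f).

Definition nonzerodivisor (A : comPzRingType) : set A :=
  [set s | forall a, s * a = 0 -> a = 0].

Lemma nonzerodivisor1 (A : comPzRingType) : nonzerodivisor (1 : A).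
Proof. by move=> a; rewrite mul1r. Qed.

Lemma nonzerodivisorM (A : comPzRingType) (s t : A) :
  nonzerodivisor s -> nonzerodivisor t -> nonzerodivisor (s * t).
Proof. by move=> hs ht a; rewrite -mulrA => /hs /ht. Qed.

Definition nonzerodivisors (A : comPzRingType) : mulSet A :=
  MulSet (@nonzerodivisor1 A) (@nonzerodivisorM A).

Section Localization.
Variables (A : comPzRingType) (S : mulSet A).

Definition loc_rel (x y : A * set_type S) : Prop :=
  exists2 u, S u & u * (x.1 * set_val y.2) = u * (y.1 * set_val x.2).

Lemma set_valP (s : set_type S) : S (set_val s).
Proof. by case: s => s hs; exact: set_mem hs. Qed.

Lemma loc_rel_refl x : loc_rel x x.
Proof. by exists 1; [exact: mul_set1|]. Qed.

Lemma loc_rel_sym x y : loc_rel x y -> loc_rel y x.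
Proof. by move=> [u hu e]; exists u. Qed.

Lemma loc_rel_trans y x z : loc_rel x y -> loc_rel y z -> loc_rel x z.
Proof.
move=> [u hu e] [v hv e']; exists (u * v * set_val y.2).
  by apply: mul_setM; [exact: mul_setM|exact: set_valP].
have -> : u * v * set_val y.2 * (x.1 * set_val z.2) =
  v * set_val z.2 * (u * (x.1 * set_val y.2)) by ring.
rewrite e; have -> : v * set_val z.2 * (u * (y.1 * set_val x.2)) =
  u * set_val x.2 * (v * (y.1 * set_val z.2)) by ring.
by rewrite e'; ring.
Qed.


Definition loc_equiv : equiv_rel (A * set_type S) :=
  equivb loc_rel_refl loc_rel_sym loc_rel_trans.

Definition loc : Type := {eq_quot loc_equiv}.

HB.instance Definition _ := Choice.copy loc {eq_quot loc_equiv}.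

Definition loc_frac (a s : A) (hs : S s) : loc :=
  \pi_({eq_quot loc_equiv}) (a, SigSub (mem_set hs)).

Lemma loc_fracP (x : loc) : exists a s (hs : S s), x = loc_frac a hs.
Proof.
have := reprK (x : {eq_quot loc_equiv}).
case: (repr _) => a [s hs] <-; exists a, s, (set_mem hs).
by rewrite /loc_frac; apply: (congr1 (fun t => \pi_({eq_quot loc_equiv}) (a, t))); exact: val_inj.
Qed.

Lemma loc_eq (a s b t : A) (hs : S s) (ht : S t) :
  loc_frac a hs = loc_frac b ht <-> exists2 u, S u & u * (a * t) = u * (b * s).
Proof.
split; last by move=> h; apply/eqmodP/asboolP.
by move/eqmodP => /asboolP.
Qed.

Definition loc_num (x : loc) : A := (repr (x : {eq_quot loc_equiv})).1.
Definition loc_den (x : loc) : A := set_val (repr (x : {eq_quot loc_equiv})).2.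

Lemma loc_denP x : S (loc_den x).
Proof. exact: set_valP. Qed.

Lemma loc_fracK x : x = loc_frac (loc_num x) (loc_denP x).
Proof.
apply: etrans (esym (reprK (x : {eq_quot loc_equiv}))) _.
rewrite [in LHS](surjective_pairing (repr _)).
apply: (congr1 (fun t => \pi_({eq_quot loc_equiv}) (_, t))); exact: val_inj.
Qed.

Definition loc_zero : loc := loc_frac 0 (mul_set1 S).
Definition loc_one : loc := loc_frac 1 (mul_set1 S).
Definition loc_opp (x : loc) : loc := loc_frac (- loc_num x) (loc_denP x).
Definition loc_add (x y : loc) : loc :=
  loc_frac (loc_num x * loc_den y + loc_num y * loc_den x)
    (mul_setM (loc_denP x) (loc_denP y)).
Definition loc_mul (x y : loc) : loc :=
  loc_frac (loc_num x * loc_num y) (mul_setM (loc_denP x) (loc_denP y)).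

Lemma loc_oppE a s (hs : S s) : loc_opp (loc_frac a hs) = loc_frac (- a) hs.
Proof.
apply/loc_eq; have [u hu e] := (loc_eq _ _ _ _).1 (loc_fracK (loc_frac a hs)).
by exists u; rewrite // !mulNr !mulrN e.
Qed.

Lemma loc_addE a s (hs : S s) b t (ht : S t) :
  loc_add (loc_frac a hs) (loc_frac b ht) =
  loc_frac (a * t + b * s) (mul_setM hs ht).
Proof.
apply/loc_eq.
have [u hu e0] := (loc_eq _ _ _ _).1 (loc_fracK (loc_frac a hs)).
have [v hv e0'] := (loc_eq _ _ _ _).1 (loc_fracK (loc_frac b ht)).
move: (loc_denP (loc_frac a hs)) (loc_denP (loc_frac b ht)) e0 e0'.
move: (loc_num (loc_frac a hs)) (loc_den (loc_frac a hs)) => a' s'.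
move: (loc_num (loc_frac b ht)) (loc_den (loc_frac b ht)) => b' t' hs' ht' e e'.
exists (u * v); first exact: mul_setM.
transitivity (v * t * t' * (u * (a' * s)) + u * s * s' * (v * (b' * t))).
  by ring.
by rewrite -e -e'; ring.
Qed.

Lemma loc_mulE a s (hs : S s) b t (ht : S t) :
  loc_mul (loc_frac a hs) (loc_frac b ht) = loc_frac (a * b) (mul_setM hs ht).
Proof.
apply/loc_eq.
have [u hu e0] := (loc_eq _ _ _ _).1 (loc_fracK (loc_frac a hs)).
have [v hv e0'] := (loc_eq _ _ _ _).1 (loc_fracK (loc_frac b ht)).
move: (loc_denP (loc_frac a hs)) (loc_denP (loc_frac b ht)) e0 e0'.
move: (loc_num (loc_frac a hs)) (loc_den (loc_frac a hs)) => a' s'.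
move: (loc_num (loc_frac b ht)) (loc_den (loc_frac b ht)) => b' t' hs' ht' e e'.
exists (u * v); first exact: mul_setM.
transitivity ((u * (a' * s)) * (v * (b' * t))); first by ring.
by rewrite -e -e'; ring.
Qed.

Lemma loc_eqW a s b t (hs : S s) (ht : S t) :
  a * t = b * s -> loc_frac a hs = loc_frac b ht.
Proof. by move=> e; apply/loc_eq; exists 1; [exact: mul_set1|rewrite e]. Qed.

Lemma loc_addA : associative loc_add.
Proof.
move=> x y z; have [a [s [hs ->]]] := loc_fracP x.
have [b [t [ht ->]]] := loc_fracP y; have [c [r [hr ->]]] := loc_fracP z.
by rewrite !loc_addE; apply: loc_eqW; ring.
Qed.

Lemma loc_addC : commutative loc_add.
Proof.
move=> x y; have [a [s [hs ->]]] := loc_fracP x.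
have [b [t [ht ->]]] := loc_fracP y.
by rewrite !loc_addE; apply: loc_eqW; ring.
Qed.

Lemma loc_add0 : left_id loc_zero loc_add.
Proof.
move=> x; have [a [s [hs ->]]] := loc_fracP x.
by rewrite loc_addE; apply: loc_eqW; ring.
Qed.

Lemma loc_addN : left_inverse loc_zero loc_opp loc_add.
Proof.
move=> x; have [a [s [hs ->]]] := loc_fracP x.
by rewrite loc_oppE loc_addE; apply: loc_eqW; ring.
Qed.

Lemma loc_mulA : associative loc_mul.
Proof.
move=> x y z; have [a [s [hs ->]]] := loc_fracP x.
have [b [t [ht ->]]] := loc_fracP y; have [c [r [hr ->]]] := loc_fracP z.
by rewrite !loc_mulE; apply: loc_eqW; ring.
Qed.

Lemma loc_mulC : commutative loc_mul.
Proof.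
move=> x y; have [a [s [hs ->]]] := loc_fracP x.
have [b [t [ht ->]]] := loc_fracP y.
by rewrite !loc_mulE; apply: loc_eqW; ring.
Qed.

Lemma loc_mul1 : left_id loc_one loc_mul.
Proof.
move=> x; have [a [s [hs ->]]] := loc_fracP x.
by rewrite loc_mulE; apply: loc_eqW; ring.
Qed.

Lemma loc_mulDl : left_distributive loc_mul loc_add.
Proof.
move=> x y z; have [a [s [hs ->]]] := loc_fracP x.
have [b [t [ht ->]]] := loc_fracP y; have [c [r [hr ->]]] := loc_fracP z.
by rewrite !(loc_mulE, loc_addE); apply: loc_eqW; ring.
Qed.

HB.instance Definition _ :=
  GRing.isZmodule.Build loc loc_addA loc_addC loc_add0 loc_addN.
HB.instance Definition _ :=
  GRing.Zmodule_isComPzRing.Build loc loc_mulA loc_mulC loc_mul1 loc_mulDl.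

Definition loc_inj (a : A) : loc := loc_frac a (mul_set1 S).

End Localization.

Section LocalizationMap.
Variables (A B : comPzRingType) (phi : {rmorphism A -> B}).
Variables (S : mulSet A) (T : mulSet B) (hST : forall s, S s -> T (phi s)).

Definition loc_map (x : loc S) : loc T :=
  loc_frac (phi (loc_num x)) (hST (loc_denP x)).

Lemma loc_mapE a s (hs : S s) :
  loc_map (loc_frac a hs) = loc_frac (phi a) (hST hs).
Proof.
apply/loc_eq; have [u hu e] := (loc_eq _ _ _ _).1 (loc_fracK (loc_frac a hs)).
by exists (phi u); [exact: hST|rewrite -!rmorphM e].
Qed.

Lemma loc_map_zmod : zmod_morphism loc_map.
Proof.
move=> x y; have [a [s [hs ->]]] := loc_fracP x.
have [b [t [ht ->]]] := loc_fracP y.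
rewrite /GRing.opp /GRing.add /= !(loc_oppE, loc_addE, loc_mapE).
by apply: loc_eqW; rewrite rmorphD !rmorphM rmorphN; ring.
Qed.

Lemma loc_map_monoid : monoid_morphism loc_map.
Proof.
split; first by rewrite /GRing.one /= loc_mapE; apply: loc_eqW; rewrite rmorph1.
move=> x y; have [a [s [hs ->]]] := loc_fracP x.
have [b [t [ht ->]]] := loc_fracP y.
rewrite /GRing.mul /= !(loc_mulE, loc_mapE).
by apply: loc_eqW; rewrite !rmorphM; ring.
Qed.

HB.instance Definition _ :=
  GRing.isZmodMorphism.Build (loc S) (loc T) loc_map loc_map_zmod.
HB.instance Definition _ :=
  GRing.isMonoidMorphism.Build (loc S) (loc T) loc_map loc_map_monoid.

End LocalizationMap.

(** The ring of fractions with respect to the nonzerodivisors is the fraction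
    field when [R] is a domain. *)
Definition normal_domain (R : comPzRingType) :=
  [/\ (1 : R) <> 0,
      (forall a b : R, a * b = 0 -> a = 0 \/ b = 0)
    & (forall x : loc (nonzerodivisors R),
        (exists (n : nat) (c : 'I_n -> R),
           x ^+ n + \sum_(i < n) loc_inj (nonzerodivisors R) (c i) * x ^+ i = 0) ->
        exists r, x = loc_inj (nonzerodivisors R) r)].

Definition normal_ring (A : comPzRingType) :=
  forall p : primeIdeal A, normal_domain (loc (prime_compl p)).

Record opens (X : topologicalType) :=
  Opens { opens_set :> X -> Prop; opensP : open opens_set }.

Lemma opens_eq (X : topologicalType) (U V : opens X) :
  opens_set U = opens_set V -> U = V.
Proof.
by case: U V => [U hU] [V hV] /= e; subst; congr Opens; exact: Prop_irrelevance.
Qed.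

Definition opens_sub (X : topologicalType) (V U : opens X) :=
  forall x, V x -> U x.

Definition opens_cap (X : topologicalType) (U V : opens X) : opens X :=
  Opens (openI (opensP U) (opensP V)).

Definition opens_full (X : topologicalType) : opens X := Opens (@openT X).

Definition opens_preim (X Y : topologicalType) (f : X -> Y)
    (hf : continuous f) (V : opens Y) : opens X :=
  Opens ((continuousP f).1 hf V (opensP V)).

Record ringedSpace := RingedSpace {
  rs_top : topologicalType;
  rs_sec : opens rs_top -> comPzRingType;
  rs_res : forall U V : opens rs_top, opens_sub V U ->
    {rmorphism rs_sec U -> rs_sec V};
  rs_res_id : forall U (h : opens_sub U U) s, rs_res h s = s;
  rs_res_comp : forall U V W (h : opens_sub V U) (k : opens_sub W V)
    (hk : opens_sub W U) s, rs_res k (rs_res h s) = rs_res hk s;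
  rs_separated : forall (U : opens rs_top) (I : Type) (V : I -> opens rs_top)
      (h : forall i, opens_sub (V i) U), (forall x, U x -> exists i, V i x) ->
    forall s t, (forall i, rs_res (h i) s = rs_res (h i) t) -> s = t;
  rs_glue : forall (U : opens rs_top) (I : Type) (V : I -> opens rs_top)
      (h : forall i, opens_sub (V i) U), (forall x, U x -> exists i, V i x) ->
    forall s : forall i, rs_sec (V i),
      (forall i j (hi : opens_sub (opens_cap (V i) (V j)) (V i))
                  (hj : opens_sub (opens_cap (V i) (V j)) (V j)),
         rs_res hi (s i) = rs_res hj (s j)) ->
    exists t, forall i, rs_res (h i) t = s i }.

Record rsMor (X Y : ringedSpace) := RsMor {
  mor_fun :> rs_top X -> rs_top Y;
  mor_cont : continuous mor_fun;
  mor_sharp : forall V : opens (rs_top Y),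
    {rmorphism rs_sec V -> rs_sec (opens_preim mor_cont V)};
  mor_nat : forall (V W : opens (rs_top Y)) (h : opens_sub W V)
      (k : opens_sub (opens_preim mor_cont W) (opens_preim mor_cont V)) s,
    mor_sharp W (rs_res h s) = rs_res k (mor_sharp V s) }.

Arguments mor_cont {X Y} r : rename.

(** A homeomorphism that is bijective on sections. *)
Definition rs_isomorphic (X Y : ringedSpace) := exists f : rsMor X Y,
  [/\ bijective f, (forall U : opens (rs_top X), open (f @` U))
    & (forall V, bijective (mor_sharp f V))].

Section OpenSubspace.
Variables (X : ringedSpace) (U : opens (rs_top X)).

Local Notation sub := (set_type (U : set (rs_top X))).

Lemma opens_lift_open (V : opens sub) : open (set_val @` (V : set sub)).
Proof.
have [W oW <-] := opensP V.
rewrite (_ : _ @` _ = W `&` U); first by apply: openI => //; exact: opensP.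
apply/seteqP; split => [_ [x Wx <-]|x [Wx Ux]].
  by split=> //; case: (x) => y hy; exact: set_mem hy.
by exists (SigSub (mem_set Ux)).
Qed.

Definition opens_lift (V : opens sub) : opens (rs_top X) :=
  Opens (opens_lift_open V).

Lemma opens_lift_sub (V W : opens sub) :
  opens_sub W V -> opens_sub (opens_lift W) (opens_lift V).
Proof. by move=> h _ [x Wx <-]; exists x => //; exact: h. Qed.

Lemma opens_lift_cover (V : opens sub) (I : Type) (W : I -> opens sub) :
  (forall x, V x -> exists i, W i x) ->
  forall x, opens_lift V x -> exists i, opens_lift (W i) x.
Proof. by move=> h _ [x /h [i Wx] <-]; exists i, x. Qed.

Lemma opens_lift_cap (V W : opens sub) :
  opens_sub (opens_cap (opens_lift V) (opens_lift W))
            (opens_lift (opens_cap V W)).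
Proof.
move=> x [[y Vy <-] [z Wz e]]; exists y => //; split=> //.
by rewrite -(val_inj e).
Qed.

Let res V W (h : opens_sub W V) := rs_res (opens_lift_sub h).

Lemma open_subspace_id V (h : opens_sub V V) s : res h s = s.
Proof. exact: rs_res_id. Qed.

Lemma open_subspace_comp V W Z (h : opens_sub W V) (k : opens_sub Z W)
  (hk : opens_sub Z V) s : res k (res h s) = res hk s.
Proof. exact: rs_res_comp. Qed.

Lemma open_subspace_separated (V : opens sub) (I : Type) (W : I -> opens sub)
    (h : forall i, opens_sub (W i) V) : (forall x, V x -> exists i, W i x) ->
  forall s t, (forall i, res (h i) s = res (h i) t) -> s = t.
Proof.
by move=> hc s t e; apply: rs_separated (opens_lift_cover hc) _ _ e.
Qed.

Lemma open_subspace_glue (V : opens sub) (I : Type) (W : I -> opens sub)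
    (h : forall i, opens_sub (W i) V) : (forall x, V x -> exists i, W i x) ->
  forall s : forall i, rs_sec (opens_lift (W i)),
    (forall i j (hi : opens_sub (opens_cap (W i) (W j)) (W i))
                (hj : opens_sub (opens_cap (W i) (W j)) (W j)),
       res hi (s i) = res hj (s j)) ->
  exists t, forall i, res (h i) t = s i.
Proof.
move=> hc s e; apply: rs_glue (opens_lift_cover hc) _ _ => i j hi hj.
have ki : opens_sub (opens_cap (W i) (W j)) (W i) by move=> x [].
have kj : opens_sub (opens_cap (W i) (W j)) (W j) by move=> x [].
have k := @opens_lift_cap (W i) (W j).
by rewrite -(rs_res_comp (opens_lift_sub ki) k) -(rs_res_comp (opens_lift_sub kj) k)
  [X in rs_res k X](e i j ki kj).
Qed.

Definition open_subspace : ringedSpace :=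
  RingedSpace open_subspace_id open_subspace_comp
    open_subspace_separated open_subspace_glue.

End OpenSubspace.

Section Stalk.
Variables (X : ringedSpace) (x : rs_top X).

Definition germ_rep :=
  {classic {U : {U : opens (rs_top X) | U x} & rs_sec (sval U)}}.

Definition germ_rel (s t : germ_rep) := exists (W : opens (rs_top X))
  (hs : opens_sub W (sval (projT1 s))) (ht : opens_sub W (sval (projT1 t))),
  W x /\ rs_res hs (projT2 s) = rs_res ht (projT2 t).

Lemma germ_rel_refl s : germ_rel s s.
Proof.
exists (sval (projT1 s)), (fun _ => id), (fun _ => id); split=> //.
exact: proj2_sig (projT1 s).
Qed.

Lemma germ_rel_sym s t : germ_rel s t -> germ_rel t s.
Proof. by move=> [W [hs [ht [Wx e]]]]; exists W, ht, hs. Qed.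

Lemma germ_rel_trans t s r : germ_rel s t -> germ_rel t r -> germ_rel s r.
Proof.
move=> [V [hs [ht [Vx e]]]] [W [ht' [hr [Wx e']]]].
have kV : opens_sub (opens_cap V W) V by move=> y [].
have kW : opens_sub (opens_cap V W) W by move=> y [].
exists (opens_cap V W), (fun y h => hs _ (kV y h)), (fun y h => hr _ (kW y h)).
split=> //.
rewrite -(rs_res_comp hs kV) e (rs_res_comp _ _ (fun y h => ht _ (kV y h))).
rewrite -(rs_res_comp hr kW) -e' (rs_res_comp _ _ (fun y h => ht' _ (kW y h))).
by congr (rs_res _ _); exact: Prop_irrelevance.
Qed.

Definition germ_equiv : equiv_rel germ_rep :=
  equivb germ_rel_refl germ_rel_sym germ_rel_trans.

Definition stalk : Type := {eq_quot germ_equiv}.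

HB.instance Definition _ := Choice.copy stalk {eq_quot germ_equiv}.

Definition germ (U : opens (rs_top X)) (Ux : U x) (s : rs_sec U) : stalk :=
  \pi_({eq_quot germ_equiv}) (existT (fun U : {U : opens _ | U x} => rs_sec (sval U))
    (exist (fun U : opens (rs_top X) => U x) U Ux) s : germ_rep).

Lemma germP (y : stalk) : exists (U : opens (rs_top X)) (Ux : U x) (s : rs_sec U), y = germ Ux s.
Proof.
have := reprK (y : {eq_quot germ_equiv}); case: (repr _) => [[U Ux] s] <-.
by exists U, Ux, s.
Qed.

Lemma germ_eq (U : opens (rs_top X)) (Ux : U x) (s : rs_sec U) (V : opens (rs_top X)) (Vx : V x) (t : rs_sec V) :
  germ Ux s = germ Vx t <-> exists (W : opens (rs_top X))
    (hU : opens_sub W U) (hV : opens_sub W V), W x /\ rs_res hU s = rs_res hV t.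
Proof.
split; last by move=> h; apply/eqmodP/asboolP.
by move/eqmodP => /asboolP.
Qed.

Lemma germ_res (U : opens (rs_top X)) (Ux : U x) (V : opens (rs_top X)) (Vx : V x) (h : opens_sub V U) (s : rs_sec U) :
  germ Vx (rs_res h s) = germ Ux s.
Proof.
apply/germ_eq; exists V, (fun _ => id), h; split=> //; exact: rs_res_id.
Qed.

Let dom (y : stalk) : opens (rs_top X) := sval (projT1 (repr (y : {eq_quot germ_equiv}))).
Let domP (y : stalk) : dom y x := proj2_sig (projT1 (repr (y : {eq_quot germ_equiv}))).
Let rep (y : stalk) : rs_sec (dom y) := projT2 (repr (y : {eq_quot germ_equiv})).

Lemma germ_rep_eq y : germ (domP y) (rep y) = y.
Proof.
have h (r : germ_rep) :
    germ (proj2_sig (projT1 r)) (projT2 r) = \pi_({eq_quot germ_equiv}) r.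
  by case: r => [[U Ux] s].
exact: etrans (h _) (reprK _).
Qed.

Let capl (U V : opens (rs_top X)) : opens_sub (opens_cap U V) U.
Proof. by move=> y []. Qed.
Let capr (U V : opens (rs_top X)) : opens_sub (opens_cap U V) V.
Proof. by move=> y []. Qed.

Definition stalk_zero : stalk := germ (I : opens_full _ x) 0.
Definition stalk_one : stalk := germ (I : opens_full _ x) 1.
Definition stalk_opp (y : stalk) : stalk := germ (domP y) (- rep y).
Definition stalk_add (y z : stalk) : stalk :=
  germ (conj (domP y) (domP z) : opens_cap _ _ x)
    (rs_res (@capl _ _) (rep y) + rs_res (@capr _ _) (rep z)).
Definition stalk_mul (y z : stalk) : stalk :=
  germ (conj (domP y) (domP z) : opens_cap _ _ x)
    (rs_res (@capl _ _) (rep y) * rs_res (@capr _ _) (rep z)).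

Lemma germ0 (U : opens (rs_top X)) (Ux : U x) : germ Ux 0 = stalk_zero.
Proof.
by apply/germ_eq; exists U, (fun _ => id), (fun _ _ => I); rewrite !rmorph0.
Qed.

Lemma germ1 (U : opens (rs_top X)) (Ux : U x) : germ Ux 1 = stalk_one.
Proof.
by apply/germ_eq; exists U, (fun _ => id), (fun _ _ => I); rewrite !rmorph1.
Qed.

Lemma germN (U : opens (rs_top X)) (Ux : U x) s : stalk_opp (germ Ux s) = germ Ux (- s).
Proof.
have /germ_eq [W [h [h' [Wx e]]]] := germ_rep_eq (germ Ux s).
by apply/germ_eq; exists W, h, h'; rewrite !rmorphN e.
Qed.

Lemma germ_rep2 (U : opens (rs_top X)) (Ux : U x) s t :
  exists (W : opens (rs_top X))
    (h : opens_sub W (opens_cap (dom (germ Ux s)) (dom (germ Ux t)))) (h' : opens_sub W U),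
  [/\ W x, rs_res h (rs_res (@capl _ _) (rep (germ Ux s))) = rs_res h' s
    & rs_res h (rs_res (@capr _ _) (rep (germ Ux t))) = rs_res h' t].
Proof.
have /germ_eq [V [h [h' [Vx e]]]] := germ_rep_eq (germ Ux s).
have /germ_eq [W [k [k' [Wx e']]]] := germ_rep_eq (germ Ux t).
have kV : opens_sub (opens_cap V W) V by move=> y [].
have kW : opens_sub (opens_cap V W) W by move=> y [].
exists (opens_cap V W), (fun y hy => conj (h _ (kV y hy)) (k _ (kW y hy))).
exists (fun y hy => h' _ (kV y hy)); split=> //.
  rewrite (rs_res_comp _ _ (fun y hy => h _ (kV y hy))) -(rs_res_comp h kV) e.
  by rewrite (rs_res_comp _ _ (fun y hy => h' _ (kV y hy))).
rewrite (rs_res_comp _ _ (fun y hy => k _ (kW y hy))) -(rs_res_comp k kW) e'.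
rewrite (rs_res_comp _ _ (fun y hy => k' _ (kW y hy))).
by congr (rs_res _ _); exact: Prop_irrelevance.
Qed.

Lemma germD (U : opens (rs_top X)) (Ux : U x) s t :
  stalk_add (germ Ux s) (germ Ux t) = germ Ux (s + t).
Proof.
have [W [h [h' [Wx e e']]]] := germ_rep2 Ux s t.
by apply/germ_eq; exists W, h, h'; rewrite !rmorphD e e'.
Qed.

Lemma germM (U : opens (rs_top X)) (Ux : U x) s t :
  stalk_mul (germ Ux s) (germ Ux t) = germ Ux (s * t).
Proof.
have [W [h [h' [Wx e e']]]] := germ_rep2 Ux s t.
by apply/germ_eq; exists W, h, h'; rewrite !rmorphM e e'.
Qed.

Lemma germ_common (y z w : stalk) : exists (U : opens (rs_top X)) (Ux : U x) (r s t : rs_sec U),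
  [/\ y = germ Ux r, z = germ Ux s & w = germ Ux t].
Proof.
have [U [Ux [r ->]]] := germP y; have [V [Vx [s ->]]] := germP z.
have [W [Wx [t ->]]] := germP w.
pose Z := opens_cap U (opens_cap V W).
have hU : opens_sub Z U by move=> ? [].
have hV : opens_sub Z V by move=> ? [? []].
have hW : opens_sub Z W by move=> ? [? []].
have Zx : Z x by [].
by exists Z, Zx, (rs_res hU r), (rs_res hV s), (rs_res hW t); rewrite !germ_res.
Qed.

Lemma stalk_addA : associative stalk_add.
Proof.
move=> y z w; have [U [Ux [r [s [t [-> -> ->]]]]]] := germ_common y z w.
by rewrite !germD addrA.
Qed.

Lemma stalk_addC : commutative stalk_add.
Proof.
move=> y z; have [U [Ux [r [s [t [-> -> _]]]]]] := germ_common y z z.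
by rewrite !germD addrC.
Qed.

Lemma stalk_add0 : left_id stalk_zero stalk_add.
Proof.
by move=> y; have [U [Ux [r ->]]] := germP y; rewrite -(germ0 Ux) germD add0r.
Qed.

Lemma stalk_addN : left_inverse stalk_zero stalk_opp stalk_add.
Proof.
move=> y; have [U [Ux [r ->]]] := germP y.
by rewrite germN germD addNr germ0.
Qed.

Lemma stalk_mulA : associative stalk_mul.
Proof.
move=> y z w; have [U [Ux [r [s [t [-> -> ->]]]]]] := germ_common y z w.
by rewrite !germM mulrA.
Qed.

Lemma stalk_mulC : commutative stalk_mul.
Proof.
move=> y z; have [U [Ux [r [s [t [-> -> _]]]]]] := germ_common y z z.
by rewrite !germM mulrC.
Qed.

Lemma stalk_mul1 : left_id stalk_one stalk_mul.
Proof.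
by move=> y; have [U [Ux [r ->]]] := germP y; rewrite -(germ1 Ux) germM mul1r.
Qed.

Lemma stalk_mulDl : left_distributive stalk_mul stalk_add.
Proof.
move=> y z w; have [U [Ux [r [s [t [-> -> ->]]]]]] := germ_common y z w.
by rewrite !(germD, germM) mulrDl.
Qed.

HB.instance Definition _ :=
  GRing.isZmodule.Build stalk stalk_addA stalk_addC stalk_add0 stalk_addN.
HB.instance Definition _ := GRing.Zmodule_isComPzRing.Build stalk
  stalk_mulA stalk_mulC stalk_mul1 stalk_mulDl.

End Stalk.

(** The coequalizer of [f] and [g] in the category of ringed spaces; see
    [coeq_universal_exists] and [coeq_universal_unique]. *)
Section Coequalizer.
Variables (Y X : ringedSpace) (f g : rsMor Y X).

Definition coeq_rel : rs_top X -> rs_top X -> Prop :=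
  clos_refl_sym_trans _ (fun a b => exists y, a = f y /\ b = g y).

Definition coeq_equiv : equiv_rel (rs_top X) :=
  equivb (@rst_refl _ _ : forall x, coeq_rel x x) (@rst_sym _ _)
    (fun y x z => @rst_trans _ _ x y z).

Definition coeq_top : topologicalType := quotient_topology {eq_quot coeq_equiv}.

Definition coeq_pi : rs_top X -> coeq_top := \pi_(coeq_top).

Lemma coeq_pi_cont : continuous coeq_pi.
Proof. exact: pi_continuous. Qed.

Lemma coeq_pi_eq y : coeq_pi (f y) = coeq_pi (g y).
Proof. by apply/eqmodP/asboolP; apply: rst_step; exists y. Qed.

Local Notation pre U := (opens_preim coeq_pi_cont U).

Lemma coeq_sub (U : opens coeq_top) :
  opens_sub (opens_preim (mor_cont g) (pre U)) (opens_preim (mor_cont f) (pre U)).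
Proof. by move=> y; rewrite /= coeq_pi_eq. Qed.

(** [f]^-1(U) and [g]^-1(U) are only propositionally equal for [U] the inverse
    image of an open set of the quotient, hence the restriction along
    [coeq_sub] in the equation defining the invariant sections. *)
Definition coeq_invariant (U : opens coeq_top) : pred (rs_sec (pre U)) :=
  fun s => `[< rs_res (@coeq_sub U) (mor_sharp f (pre U) s) = mor_sharp g (pre U) s >].

Definition coeq_sec (U : opens coeq_top) := {s | @coeq_invariant U s}.

Lemma coeq_invariant_subring (U : opens coeq_top) :
  subring_closed (@coeq_invariant U).
Proof.
split=> [|s t /asboolP hs /asboolP ht|s t /asboolP hs /asboolP ht];
  apply/asboolP; first by rewrite !rmorph1.
  by rewrite !rmorphB hs ht.
by rewrite !rmorphM hs ht.
Qed.

HB.instance Definition _ (U : opens coeq_top) := SubType.on (coeq_sec U).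
HB.instance Definition _ (U : opens coeq_top) := Choice.on (coeq_sec U).
HB.instance Definition _ (U : opens coeq_top) :=
  GRing.SubChoice_isSubComPzRing.Build _ _ (coeq_sec U)
    (@coeq_invariant_subring U).

Lemma coeq_pre_sub (U V : opens coeq_top) : opens_sub V U ->
  opens_sub (pre V) (pre U).
Proof. by move=> h x; exact: h. Qed.

Lemma coeq_resP (U V : opens coeq_top) (h : opens_sub V U) (s : coeq_sec U) :
  @coeq_invariant V (rs_res (coeq_pre_sub h) (val s)).
Proof.
have /asboolP e := valP s; apply/asboolP.
have hf : opens_sub (opens_preim (mor_cont f) (pre V))
  (opens_preim (mor_cont f) (pre U)) by move=> y; exact: h.
have hg : opens_sub (opens_preim (mor_cont g) (pre V))
  (opens_preim (mor_cont g) (pre U)) by move=> y; exact: h.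
rewrite (mor_nat _ hf) (mor_nat _ hg) -e.
rewrite (rs_res_comp _ _ (fun y hy => hf _ (coeq_sub hy))).
rewrite (rs_res_comp _ _ (fun y hy => hf _ (coeq_sub hy))).
by [].
Qed.

Definition coeq_res (U V : opens coeq_top) (h : opens_sub V U) (s : coeq_sec U) :
  coeq_sec V := exist (fun s => @coeq_invariant V s) _ (coeq_resP h s).

Lemma coeq_res_zmod U V (h : opens_sub V U) : zmod_morphism (coeq_res h).
Proof. by move=> s t; apply: val_inj; rewrite /= rmorphB. Qed.

Lemma coeq_res_monoid U V (h : opens_sub V U) : monoid_morphism (coeq_res h).
Proof.
by split=> [|s t]; apply: val_inj; rewrite /= ?rmorph1 ?rmorphM.
Qed.

HB.instance Definition _ U V (h : opens_sub V U) :=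
  GRing.isZmodMorphism.Build (coeq_sec U) (coeq_sec V) (coeq_res h)
    (coeq_res_zmod h).
HB.instance Definition _ U V (h : opens_sub V U) :=
  GRing.isMonoidMorphism.Build (coeq_sec U) (coeq_sec V) (coeq_res h)
    (coeq_res_monoid h).

Let sec (U : opens coeq_top) : comPzRingType := coeq_sec U.
Let res U V (h : opens_sub V U) : {rmorphism sec U -> sec V} := coeq_res h.

Lemma coeq_res_id U (h : opens_sub U U) s : res h s = s.
Proof. by apply: val_inj => /=; exact: rs_res_id. Qed.

Lemma coeq_res_comp U V W (h : opens_sub V U) (k : opens_sub W V)
  (hk : opens_sub W U) s : res k (res h s) = res hk s.
Proof. by apply: val_inj => /=; exact: rs_res_comp. Qed.

Lemma coeq_separated (U : opens coeq_top) (I : Type) (V : I -> opens coeq_top)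
    (h : forall i, opens_sub (V i) U) : (forall x, U x -> exists i, V i x) ->
  forall s t, (forall i, res (h i) s = res (h i) t) -> s = t.
Proof.
move=> hc s t e; apply: val_inj.
apply: (@rs_separated _ (pre U) I (fun i => pre (V i)) (fun i => coeq_pre_sub (h i))).
  by move=> x; exact: hc.
by move=> i; exact: (congr1 val (e i)).
Qed.

Lemma coeq_glue (U : opens coeq_top) (I : Type) (V : I -> opens coeq_top)
    (h : forall i, opens_sub (V i) U) : (forall x, U x -> exists i, V i x) ->
  forall s : forall i, sec (V i),
    (forall i j (hi : opens_sub (opens_cap (V i) (V j)) (V i))
                (hj : opens_sub (opens_cap (V i) (V j)) (V j)),
       res hi (s i) = res hj (s j)) ->
  exists t, forall i, res (h i) t = s i.
Proof.
move=> hc s e.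
have hc' x : pre U x -> exists i, pre (V i) x by exact: hc.
have [|t ht] := @rs_glue _ (pre U) I (fun i => pre (V i))
  (fun i => coeq_pre_sub (h i)) hc' (fun i => val (s i)).
  move=> i j hi hj.
  have ki : opens_sub (opens_cap (V i) (V j)) (V i) by move=> x [].
  have kj : opens_sub (opens_cap (V i) (V j)) (V j) by move=> x [].
  have l : opens_sub (opens_cap (pre (V i)) (pre (V j)))
    (pre (opens_cap (V i) (V j))) by [].
  rewrite -(rs_res_comp (coeq_pre_sub ki) l) -(rs_res_comp (coeq_pre_sub kj) l).
  by congr (rs_res _ _); exact: (congr1 val (e i j ki kj)).
have tinv : @coeq_invariant U t.
  have hg i : opens_sub (opens_preim (mor_cont g) (pre (V i)))
    (opens_preim (mor_cont g) (pre U)) by move=> y; exact: h.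
  have hcg y : opens_preim (mor_cont g) (pre U) y ->
    exists i, opens_preim (mor_cont g) (pre (V i)) y by exact: hc.
  apply/asboolP; apply: (rs_separated (h := hg) hcg).
  move=> i; have /asboolP hi := valP (s i).
  have hf : opens_sub (opens_preim (mor_cont f) (pre (V i)))
    (opens_preim (mor_cont f) (pre U)) by move=> y; exact: h.
  rewrite -(mor_nat (coeq_pre_sub (h i))) ht -hi -ht (mor_nat _ hf).
  rewrite (rs_res_comp _ _ (fun y hy => hf _ (coeq_sub hy))).
  rewrite (rs_res_comp _ _ (fun y hy => hf _ (coeq_sub hy))).
  by [].
by exists (exist (fun s => @coeq_invariant U s) t tinv) => i; apply: val_inj; exact: ht.
Qed.

Definition coequalizer : ringedSpace :=
  RingedSpace coeq_res_id coeq_res_comp coeq_separated coeq_glue.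

Definition coeq_incl (V : opens coeq_top) (s : sec V) : rs_sec (pre V) := val s.

Lemma coeq_incl_zmod V : zmod_morphism (@coeq_incl V).
Proof. by move=> s t; rewrite /coeq_incl rmorphB. Qed.

Lemma coeq_incl_monoid V : monoid_morphism (@coeq_incl V).
Proof. by split=> [|s t]; rewrite /coeq_incl ?rmorph1 ?rmorphM. Qed.

HB.instance Definition _ V := GRing.isZmodMorphism.Build (sec V)
  (rs_sec (pre V)) (@coeq_incl V) (@coeq_incl_zmod V).
HB.instance Definition _ V := GRing.isMonoidMorphism.Build (sec V)
  (rs_sec (pre V)) (@coeq_incl V) (@coeq_incl_monoid V).

Lemma coeq_incl_nat (V W : opens coeq_top) (h : opens_sub W V)
    (k : opens_sub (pre W) (pre V)) (s : sec V) :
  coeq_incl (res h s) = rs_res k (coeq_incl s).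
Proof. by congr (rs_res _ _); exact: Prop_irrelevance. Qed.

Definition coeq_mor : rsMor X coequalizer :=
  @RsMor X coequalizer coeq_pi coeq_pi_cont (fun V => @coeq_incl V)
    coeq_incl_nat.

Section UniversalProperty.
Variables (Z : ringedSpace) (h : rsMor X Z).
Hypothesis h_eq : forall y, h (f y) = h (g y).
Hypothesis h_sharp_eq : forall (V : opens (rs_top Z))
  (k : opens_sub (opens_preim (mor_cont g) (opens_preim (mor_cont h) V))
                 (opens_preim (mor_cont f) (opens_preim (mor_cont h) V))) s,
  rs_res k (mor_sharp f _ (mor_sharp h V s)) = mor_sharp g _ (mor_sharp h V s).

Let k (q : coeq_top) : rs_top Z := h (repr q).

Let h_rel a b : coeq_rel a b -> h a = h b.
Proof. by elim=> {a b} [a b [y [-> ->]]|//|a b _ ->|a b c _ -> _ ->]. Qed.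

Let k_pi x : k (coeq_pi x) = h x.
Proof.
have /eqmodP /asboolP : \pi_(coeq_top) (repr (coeq_pi x)) = \pi_(coeq_top) x.
  exact: reprK.
exact: h_rel.
Qed.

Let k_cont : continuous k.
Proof.
apply/quotient_continuous; rewrite (_ : _ \o _ = h); first exact: mor_cont.
by apply/funext => x; exact: k_pi.
Qed.

Let k_sub V : opens_sub (pre (opens_preim k_cont V)) (opens_preim (mor_cont h) V).
Proof. by move=> x /=; rewrite -[X in _ -> _ X]k_pi. Qed.

Let k_sub' V : opens_sub (opens_preim (mor_cont h) V) (pre (opens_preim k_cont V)).
Proof. by move=> x /= Vx; rewrite /preimage /= k_pi. Qed.

Let k_inv (V : opens (rs_top Z)) (s : rs_sec V) :
  @coeq_invariant (opens_preim k_cont V) (rs_res (@k_sub V) (mor_sharp h V s)).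
Proof.
apply/asboolP.
have l : opens_sub (opens_preim (mor_cont g) (opens_preim (mor_cont h) V))
    (opens_preim (mor_cont f) (opens_preim (mor_cont h) V)).
  by move=> y; rewrite /= /preimage /= h_eq.
have lf : opens_sub (opens_preim (mor_cont f) (pre (opens_preim k_cont V)))
    (opens_preim (mor_cont f) (opens_preim (mor_cont h) V)).
  by move=> y; exact: k_sub.
have lg : opens_sub (opens_preim (mor_cont g) (pre (opens_preim k_cont V)))
    (opens_preim (mor_cont g) (opens_preim (mor_cont h) V)).
  by move=> y; exact: k_sub.
rewrite (mor_nat _ lf) (mor_nat _ lg) -(h_sharp_eq l).
rewrite (rs_res_comp _ _ (fun y hy => l _ (lg y hy))).
rewrite (rs_res_comp _ _ (fun y hy => lf _ (coeq_sub hy))).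
by congr (rs_res _ _); exact: Prop_irrelevance.
Qed.

Let k_sharp V (s : rs_sec V) : sec (opens_preim k_cont V) :=
  exist (fun s => @coeq_invariant (opens_preim k_cont V) s) _ (k_inv s).

Let k_zmod V : zmod_morphism (@k_sharp V).
Proof. by move=> s t; apply: val_inj; rewrite /= !rmorphB. Qed.

Let k_monoid V : monoid_morphism (@k_sharp V).
Proof. by split=> [|s t]; apply: val_inj; rewrite /= ?rmorph1 ?rmorphM. Qed.

HB.instance Definition _ V := GRing.isZmodMorphism.Build (rs_sec V)
  (sec (opens_preim k_cont V)) (@k_sharp V) (@k_zmod V).
HB.instance Definition _ V := GRing.isMonoidMorphism.Build (rs_sec V)
  (sec (opens_preim k_cont V)) (@k_sharp V) (@k_monoid V).

Let k_nat (V W : opens (rs_top Z)) (l : opens_sub W V)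
    (m : opens_sub (opens_preim k_cont W) (opens_preim k_cont V)) s :
  k_sharp (rs_res l s) = res m (k_sharp s).
Proof.
apply: val_inj => /=.
have n : opens_sub (opens_preim (mor_cont h) W) (opens_preim (mor_cont h) V).
  by move=> x; exact: l.
rewrite (mor_nat _ n).
rewrite (rs_res_comp _ _ (fun x hx => n _ (k_sub hx))).
rewrite (rs_res_comp _ _ (fun x hx => n _ (k_sub hx))).
by [].
Qed.

Definition factors (m : rsMor coequalizer Z) :=
  (forall x, m (coeq_mor x) = h x) /\
  forall (V : opens (rs_top Z))
    (l : opens_sub (opens_preim (mor_cont h) V)
                   (opens_preim (mor_cont coeq_mor) (opens_preim (mor_cont m) V))) s,
    rs_res l (mor_sharp coeq_mor _ (mor_sharp m V s)) = mor_sharp h V s.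

Lemma coeq_universal_exists : exists m, factors m.
Proof.
exists (@RsMor coequalizer Z k k_cont (fun V => @k_sharp V) k_nat).
split=> [|V l s] /=; first exact: k_pi.
rewrite (rs_res_comp _ _ (fun x hx => hx)); exact: rs_res_id.
Qed.

Lemma coeq_universal_unique m m' : factors m -> factors m' ->
  (forall q, m q = m' q) /\
  forall (V : opens (rs_top Z))
    (l : opens_sub (opens_preim (mor_cont m') V) (opens_preim (mor_cont m) V)) s,
    rs_res l (mor_sharp m V s) = mor_sharp m' V s.
Proof.
move=> [hm sm] [hm' sm'].
have e q : m q = m' q by rewrite -[q]reprK; exact: etrans (hm _) (esym (hm' _)).
split=> // V l s; apply: val_inj.
have n : opens_sub (opens_preim (mor_cont h) V)
    (opens_preim (mor_cont coeq_mor) (opens_preim (mor_cont m) V)).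
  by move=> x; rewrite /= /preimage /= hm.
have n' : opens_sub (opens_preim (mor_cont h) V)
    (opens_preim (mor_cont coeq_mor) (opens_preim (mor_cont m') V)).
  by move=> x; rewrite /= /preimage /= hm'.
have r : opens_sub (opens_preim (mor_cont coeq_mor) (opens_preim (mor_cont m') V))
    (opens_preim (mor_cont h) V).
  by move=> x; rewrite /= /preimage /= hm'.
have := congr1 (rs_res r) (etrans (sm V n s) (esym (sm' V n' s))).
rewrite (rs_res_comp _ _ (fun x hx => n x (r x hx))).
rewrite (rs_res_comp _ _ (fun x hx => hx)) rs_res_id => <-.
by congr (rs_res _ _); exact: Prop_irrelevance.
Qed.

End UniversalProperty.

End Coequalizer.

Section SpecTopology.
Variable A : comPzRingType.

Definition zariski_open (U : set (primeIdeal A)) :=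
  exists E : set A, U = [set p : primeIdeal A | ~ (E `<=` p)].

Lemma zariski_openT : zariski_open setT.
Proof.
exists setT; apply/seteqP; split=> // p _ /(_ 1 I); case: (primeP p) => _ n1 _.
exact: n1.
Qed.

Lemma zariski_openI : setI_closed zariski_open.
Proof.
move=> _ _ [E ->] [F ->]; exists [set x | exists a b, [/\ E a, F b & x = a * b]].
apply/seteqP; split=> p.
  move=> [/existsNP [a /not_implyP [Ea pa]]] /existsNP [b /not_implyP [Fb pb]].
  move=> /(_ (a * b)) h; case: (primeP p) => _ _ /(_ a b) hp.
  by case: hp => //; apply: h; exists a, b.
move=> h; split=> hE; apply: h => _ [a [b [Ea Fb ->]]];
  case: (primeP p) => [[_ _ hp] _ _].
  by rewrite mulrC; apply: hp; exact: hE.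
by apply: hp; exact: hE.
Qed.

Lemma zariski_open_bigU (I : Type) (f : I -> set (primeIdeal A)) :
  (forall i, zariski_open (f i)) -> zariski_open (\bigcup_i f i).
Proof.
move=> /choice [E hE]; exists (\bigcup_i E i); apply/seteqP; split=> p.
  by move=> [i _]; rewrite hE => h h'; apply: h => a Ea; apply: h'; exists i.
move=> /existsNP [a /not_implyP [[i _ Ea] pa]]; exists i => //.
by rewrite hE => /(_ a Ea).
Qed.

HB.instance Definition _ := gen_eqMixin (primeIdeal A).
HB.instance Definition _ := gen_choiceMixin (primeIdeal A).
HB.instance Definition _ := isOpenTopological.Build (primeIdeal A)
  zariski_openT zariski_openI zariski_open_bigU.

End SpecTopology.

Section SpecSheaf.
Variable A : comPzRingType.
Implicit Types U V W : opens (primeIdeal A).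

Definition locally_fraction U
    (s : forall p : primeIdeal A, U p -> loc (prime_compl p)) :=
  forall p, U p -> exists V (h : opens_sub V U) (a b : A), V p /\
    forall q (Vq : V q), exists hb : prime_compl q b,
      s q (h q Vq) = loc_frac a hb.

Record spec_sec U := SpecSec {
  sec_fun :> forall p : primeIdeal A, U p -> loc (prime_compl p);
  secP : locally_fraction sec_fun }.

Lemma sec_eq U (s t : spec_sec U) : (forall p Up, s p Up = t p Up) -> s = t.
Proof.
case: s t => [s hs] [t ht] /= e.
have e' : s = t by apply: functional_extensionality_dep => p;
  apply: functional_extensionality_dep => Up; exact: e.
by subst; congr SpecSec; exact: Prop_irrelevance.
Qed.

HB.instance Definition _ U := gen_eqMixin (spec_sec U).
HB.instance Definition _ U := gen_choiceMixin (spec_sec U).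

Lemma sec_const_subproof U (a : A) :
  @locally_fraction U (fun p _ => loc_inj (prime_compl p) a).
Proof.
move=> p Up; exists U, (fun _ => id), a, 1; split=> // q Uq.
by exists (mul_set1 (prime_compl q)).
Qed.

Definition sec_const U (a : A) : spec_sec U := SpecSec (@sec_const_subproof U a).

Lemma sec_opp_subproof U (s : spec_sec U) :
  @locally_fraction U (fun p Up => - s p Up).
Proof.
move=> p /(secP s) [V [h [a [b [Vp e]]]]]; exists V, h, (- a), b.
by split=> // q Vq; have [hb ->] := e q Vq; exists hb; exact: loc_oppE.
Qed.

Lemma sec_add_subproof U (s t : spec_sec U) :
  @locally_fraction U (fun p Up => s p Up + t p Up).
Proof.
move=> p Up; have [V [h [a [b [Vp e]]]]] := secP s Up.
have [W [h' [a' [b' [Wp e']]]]] := secP t Up.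
exists (opens_cap V W), (fun q hq => h _ (proj1 hq)), (a * b' + a' * b), (b * b').
split=> // q [Vq Wq]; have [hb /= eq] := e q Vq; have [hb' /= eq'] := e' q Wq.
exists (mul_setM (m := prime_compl q) hb hb').
rewrite (Prop_irrelevance (h q _) (h q Vq)) eq.
by rewrite (Prop_irrelevance (h q Vq) (h' q Wq)) eq'; exact: loc_addE.
Qed.

Lemma sec_mul_subproof U (s t : spec_sec U) :
  @locally_fraction U (fun p Up => s p Up * t p Up).
Proof.
move=> p Up; have [V [h [a [b [Vp e]]]]] := secP s Up.
have [W [h' [a' [b' [Wp e']]]]] := secP t Up.
exists (opens_cap V W), (fun q hq => h _ (proj1 hq)), (a * a'), (b * b').
split=> // q [Vq Wq]; have [hb /= eq] := e q Vq; have [hb' /= eq'] := e' q Wq.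
exists (mul_setM (m := prime_compl q) hb hb').
rewrite (Prop_irrelevance (h q _) (h q Vq)) eq.
by rewrite (Prop_irrelevance (h q Vq) (h' q Wq)) eq'; exact: loc_mulE.
Qed.

Definition sec_opp U (s : spec_sec U) := SpecSec (sec_opp_subproof s).
Definition sec_add U (s t : spec_sec U) := SpecSec (sec_add_subproof s t).
Definition sec_mul U (s t : spec_sec U) := SpecSec (sec_mul_subproof s t).

Lemma sec_addA U : associative (@sec_add U).
Proof. by move=> r s t; apply: sec_eq => p Up; exact: addrA. Qed.

Lemma sec_addC U : commutative (@sec_add U).
Proof. by move=> s t; apply: sec_eq => p Up; exact: addrC. Qed.

Lemma sec_add0 U : left_id (sec_const U 0) (@sec_add U).
Proof. by move=> s; apply: sec_eq => p Up; exact: add0r. Qed.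

Lemma sec_addN U : left_inverse (sec_const U 0) (@sec_opp U) (@sec_add U).
Proof. by move=> s; apply: sec_eq => p Up; exact: addNr. Qed.

Lemma sec_mulA U : associative (@sec_mul U).
Proof. by move=> r s t; apply: sec_eq => p Up; exact: mulrA. Qed.

Lemma sec_mulC U : commutative (@sec_mul U).
Proof. by move=> s t; apply: sec_eq => p Up; exact: mulrC. Qed.

Lemma sec_mul1 U : left_id (sec_const U 1) (@sec_mul U).
Proof. by move=> s; apply: sec_eq => p Up; exact: mul1r. Qed.

Lemma sec_mulDl U : left_distributive (@sec_mul U) (@sec_add U).
Proof. by move=> r s t; apply: sec_eq => p Up; exact: mulrDl. Qed.

HB.instance Definition _ U := GRing.isZmodule.Build (spec_sec U)
  (@sec_addA U) (@sec_addC U) (@sec_add0 U) (@sec_addN U).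
HB.instance Definition _ U := GRing.Zmodule_isComPzRing.Build (spec_sec U)
  (@sec_mulA U) (@sec_mulC U) (@sec_mul1 U) (@sec_mulDl U).

Lemma spec_res_subproof U V (h : opens_sub V U) (s : spec_sec U) :
  @locally_fraction V (fun p Vp => s p (h p Vp)).
Proof.
move=> p Vp; have [W [k [a [b [Wp e]]]]] := secP s (h p Vp).
exists (opens_cap V W), (fun q hq => proj1 hq), a, b; split=> // q [Vq Wq].
by have [hb eq] := e q Wq; exists hb; rewrite -eq; congr (s q _);
  exact: Prop_irrelevance.
Qed.

Definition spec_res U V (h : opens_sub V U) (s : spec_sec U) : spec_sec V :=
  SpecSec (spec_res_subproof h s).

Lemma spec_res_zmod U V (h : opens_sub V U) : zmod_morphism (spec_res h).
Proof. by move=> s t; apply: sec_eq. Qed.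

Lemma spec_res_monoid U V (h : opens_sub V U) : monoid_morphism (spec_res h).
Proof. by split=> [|s t]; apply: sec_eq. Qed.

HB.instance Definition _ U V (h : opens_sub V U) :=
  GRing.isZmodMorphism.Build (spec_sec U) (spec_sec V) (spec_res h)
    (spec_res_zmod h).
HB.instance Definition _ U V (h : opens_sub V U) :=
  GRing.isMonoidMorphism.Build (spec_sec U) (spec_sec V) (spec_res h)
    (spec_res_monoid h).

Let sec U : comPzRingType := spec_sec U.
Let res U V (h : opens_sub V U) : {rmorphism sec U -> sec V} := spec_res h.

Lemma spec_res_id U (h : opens_sub U U) s : res h s = s.
Proof.
by apply: sec_eq => p Up /=; congr (sec_fun s _); exact: Prop_irrelevance.
Qed.

Lemma spec_res_comp U V W (h : opens_sub V U) (k : opens_sub W V)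
  (hk : opens_sub W U) s : res k (res h s) = res hk s.
Proof.
by apply: sec_eq => p Up /=; congr (sec_fun s _); exact: Prop_irrelevance.
Qed.

Lemma spec_separated U (I : Type) (V : I -> opens (primeIdeal A))
    (h : forall i, opens_sub (V i) U) : (forall x, U x -> exists i, V i x) ->
  forall s t, (forall i, res (h i) s = res (h i) t) -> s = t.
Proof.
move=> hc s t e; apply: sec_eq => p Up; have [i Vp] := hc p Up.
rewrite (Prop_irrelevance Up (h i p Vp)).
exact: (congr1 (fun r : spec_sec (V i) => r p Vp) (e i)).
Qed.

Lemma spec_glue U (I : Type) (V : I -> opens (primeIdeal A))
    (h : forall i, opens_sub (V i) U) : (forall x, U x -> exists i, V i x) ->
  forall s : forall i, sec (V i),
    (forall i j (hi : opens_sub (opens_cap (V i) (V j)) (V i))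
                (hj : opens_sub (opens_cap (V i) (V j)) (V j)),
       res hi (s i) = res hj (s j)) ->
  exists t, forall i, res (h i) t = s i.
Proof.
move=> hc s e.
pose t p Up : loc (prime_compl p) :=
  s (projT1 (cid (hc p Up))) p (projT2 (cid (hc p Up))).
have tE i p Up (Vp : V i p) : t p Up = s i p Vp.
  rewrite /t; case: (cid _) => j Vp' /=.
  have kj : opens_sub (opens_cap (V j) (V i)) (V j) by move=> q [].
  have ki : opens_sub (opens_cap (V j) (V i)) (V i) by move=> q [].
  have Wp : opens_cap (V j) (V i) p by [].
  have /= := congr1 (fun r : spec_sec _ => r p Wp) (e j i kj ki).
  rewrite (Prop_irrelevance (kj p Wp) Vp') (Prop_irrelevance (ki p Wp) Vp) => <-.
  by congr (sec_fun _ _); exact: Prop_irrelevance.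
have ht : locally_fraction t.
  move=> p Up; have [i Vp] := hc p Up; have [W [k [a [b [Wp eW]]]]] := secP (s i) Vp.
  exists W, (fun q Wq => h i q (k q Wq)), a, b; split=> // q Wq.
  by have [hb eq] := eW q Wq; exists hb; rewrite (tE i _ _ (k q Wq)).
by exists (SpecSec ht) => i; apply: sec_eq => p Vp /=; exact: tE.
Qed.

Definition Spec : ringedSpace :=
  RingedSpace spec_res_id spec_res_comp spec_separated spec_glue.

End SpecSheaf.

Section SpecMap.
Variables (A B : comPzRingType) (phi : {rmorphism A -> B}).

Lemma comap_prime (q : primeIdeal B) : is_prime (phi @^-1` q).
Proof.
case: (primeP q) => [[q0 qD qM] q1 qP]; split; first split; rewrite /preimage /=.
- by rewrite rmorph0.
- by move=> a b ha hb; rewrite rmorphD; exact: qD.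
- by move=> a b hb; rewrite rmorphM; exact: qM.
- by rewrite rmorph1.
- by move=> a b; rewrite rmorphM; exact: qP.
Qed.

Definition comap (q : primeIdeal B) : primeIdeal A := PrimeIdeal (comap_prime q).

Lemma comap_continuous : continuous comap.
Proof.
apply/continuousP => _ [E ->]; exists (phi @` E); apply/seteqP; split=> q /= h h';
  apply: h => a Ea; last by case: Ea => b Eb <-; exact: h'.
by apply: h'; exists a.
Qed.

Lemma comap_compl (q : primeIdeal B) a :
  prime_compl (comap q) a -> prime_compl q (phi a).
Proof. by []. Qed.

Lemma spec_sharp_subproof (V : opens (primeIdeal A)) (s : spec_sec V) :
  @locally_fraction B (opens_preim comap_continuous V)
    (fun q Vq => loc_map (@comap_compl q) (s (comap q) Vq)).
Proof.
move=> q Vq; have [W [h [a [b [Wq e]]]]] := secP s Vq.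
exists (opens_preim comap_continuous W), (fun r Wr => h _ Wr), (phi a), (phi b).
split=> // r Wr; have [hb eq] := e _ Wr; exists hb.
by rewrite eq loc_mapE; exact: loc_eqW.
Qed.

Definition spec_sharp (V : opens (primeIdeal A)) (s : spec_sec V) :
  spec_sec (opens_preim comap_continuous V) := SpecSec (spec_sharp_subproof s).

Lemma spec_sharp_zmod V : zmod_morphism (@spec_sharp V).
Proof. by move=> s t; apply: sec_eq => q Vq; exact: rmorphB. Qed.

Lemma spec_sharp_monoid V : monoid_morphism (@spec_sharp V).
Proof.
by split=> [|s t]; apply: sec_eq => q Vq; [exact: rmorph1|exact: rmorphM].
Qed.

HB.instance Definition _ V := GRing.isZmodMorphism.Build (spec_sec V)
  (spec_sec (opens_preim comap_continuous V)) (@spec_sharp V)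
  (@spec_sharp_zmod V).
HB.instance Definition _ V := GRing.isMonoidMorphism.Build (spec_sec V)
  (spec_sec (opens_preim comap_continuous V)) (@spec_sharp V)
  (@spec_sharp_monoid V).

Let sharp (V : opens (rs_top (Spec A))) : {rmorphism rs_sec V ->
    @rs_sec (Spec B) (opens_preim comap_continuous V)} := @spec_sharp V.

Lemma spec_sharp_nat (V W : opens (rs_top (Spec A))) (h : opens_sub W V)
    (k : opens_sub (opens_preim comap_continuous W)
                   (opens_preim comap_continuous V)) s :
  sharp W (rs_res h s) = @rs_res (Spec B) _ _ k (sharp V s).
Proof.
apply: sec_eq => q Wq /=; congr (loc_map _ (sec_fun s _)).
exact: Prop_irrelevance.
Qed.

Definition Spec_map : rsMor (Spec B) (Spec A) :=
  @RsMor (Spec B) (Spec A) comap comap_continuous sharp spec_sharp_nat.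

End SpecMap.

(** An isomorphism of ringed spaces onto an affine scheme transports local
    rings, so that schemes may be defined without locally ringed spaces. *)
Definition is_scheme (X : ringedSpace) := forall x : rs_top X,
  exists U : opens (rs_top X), U x /\
    exists B : comPzRingType, rs_isomorphic (open_subspace U) (Spec B).

Definition normal_scheme (X : ringedSpace) :=
  is_scheme X /\ forall x : rs_top X, normal_domain (stalk x).

Definition finitely_generated (D : zmodType) :=
  exists (n : nat) (g : 'I_n -> D), forall d, exists c : 'I_n -> int,
    d = \sum_i g i *~ c i.

(** Finitely many cosets of [H] cover [D]. *)
Definition finite_index (D : zmodType) (H : set D) :=
  exists r : seq D, forall d, exists2 x, x \in r & H (d - x).

Record grading (D : zmodType) (A : comPzRingType) := Grading {
  piece :> D -> A -> Prop;
  piece0 : forall d, piece d 0;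
  pieceB : forall d a b, piece d a -> piece d b -> piece d (a - b);
  piece1 : piece 0 1;
  pieceM : forall d e a b, piece d a -> piece e b -> piece (d + e) (a * b);
  piece_direct : forall a, exists! c : D -> A,
    [/\ forall d, piece d (c d), finite_set [set d | c d != 0]
      & a = \sum_(d \in setT) c d] }.

Definition homogeneous (D : zmodType) (A : comPzRingType) (G : grading D A)
  (f : A) := exists d, G d f.

Definition periodic (D : zmodType) (B : comPzRingType) (Bd : D -> B -> Prop) :=
  finite_index [set d | exists2 g, Bd d g & exists h, g * h = 1].

(** The degree [d] part of [A_f]: the fractions [a / f ^+ n] with [a] of degree
    [d + n deg f]. The degree [e] of [f] is quantified because it is not unique
    when [f = 0]. *)
Definition loc_piece (D : zmodType) (A : comPzRingType) (G : grading D A)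
    (f : A) (d : D) (x : loc (powers f)) := exists (e : D) (n : nat) (a : A)
  (hf : powers f (f ^+ n)), [/\ G e f, G (d + e *+ n) a & x = loc_frac a hf].

Definition relevant (D : zmodType) (A : comPzRingType) (G : grading D A)
  (f : A) := homogeneous G f /\ periodic (@loc_piece D A G f).

Section GroupAlgebra.
Variables (A : comPzRingType) (D : zmodType).

Record groupAlg := GroupAlg {
  ga_coef :> D -> A;
  ga_finite : finite_set [set d | ga_coef d != 0] }.

Implicit Types (f g h : groupAlg).

Lemma ga_eq f g : (forall d, f d = g d) -> f = g.
Proof.
case: f g => [f hf] [g hg] /= /funext e; subst; congr GroupAlg.
exact: Prop_irrelevance.
Qed.

HB.instance Definition _ := gen_eqMixin groupAlg.
HB.instance Definition _ := gen_choiceMixin groupAlg.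

Definition ga_supp f : {fset D} := fset_set [set d | f d != 0].

Lemma ga_suppP f d : d \notin ga_supp f -> f d = 0.
Proof.
rewrite in_fset_set; last exact: ga_finite.
by apply: contraNeq => h; apply/mem_set.
Qed.

Lemma fset_finite (S : {fset D}) (c : D -> A) :
  (forall d, d \notin S -> c d = 0) -> finite_set [set d | c d != 0].
Proof.
move=> h; apply: (sub_finite_set _ (finite_fset S)) => d /=.
by apply: contraNT => /h ->.
Qed.

Lemma ga_mono_finite (a : A) (d : D) :
  finite_set [set e | (if e == d then a else 0) != 0].
Proof.
apply: (@fset_finite [fset d]%fset) => e; rewrite inE.
by move=> /negbTE ->.
Qed.

Definition ga_mono (a : A) (d : D) : groupAlg := GroupAlg (ga_mono_finite a d).

Lemma ga_opp_finite f : finite_set [set d | - f d != 0].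
Proof.
by apply: (@fset_finite (ga_supp f)) => d /ga_suppP ->; rewrite oppr0.
Qed.

Lemma ga_add_finite f g : finite_set [set d | f d + g d != 0].
Proof.
apply: (@fset_finite (ga_supp f `|` ga_supp g)%fset) => d.
by rewrite inE negb_or => /andP [/ga_suppP -> /ga_suppP ->]; rewrite addr0.
Qed.

Definition conv (f g : D -> A) (d : D) : A :=
  \sum_(e \in setT) f e * g (d - e).

Lemma convE f (g : D -> A) d : conv f g d = \sum_(e <- ga_supp f) f e * g (d - e).
Proof.
by rewrite /conv (fsbigTE (ga_supp f)) // => e /ga_suppP ->; rewrite mul0r.
Qed.

Definition sum_supp f g : {fset D} :=
  [fset (x + y)%R | x in ga_supp f, y in ga_supp g]%fset.

Lemma sum_suppP f g c d : c \in ga_supp f -> d \notin sum_supp f g ->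
  g (d - c) = 0.
Proof.
move=> hc hd; apply: ga_suppP; apply: contra hd => hd.
apply/imfset2P; exists c => //; exists (d - c) => //.
by rewrite addrC subrK.
Qed.

Lemma conv_supp f g d : d \notin sum_supp f g -> conv f g d = 0.
Proof.
move=> hd; rewrite convE big_seq big1 // => c hc.
by rewrite (sum_suppP hc hd) mulr0.
Qed.

Lemma ga_mul_finite f g : finite_set [set d | conv f g d != 0].
Proof. exact: (fset_finite (@conv_supp f g)). Qed.

Lemma conv_sum f g (t : D -> A) :
  \sum_(e \in setT) conv f g e * t e =
  \sum_(c <- ga_supp f) f c * \sum_(e \in setT) g e * t (c + e).
Proof.
rewrite (fsbigTE (sum_supp f g)); last first.
  by move=> e /conv_supp ->; rewrite mul0r.
transitivity (\sum_(e <- sum_supp f g) \sum_(c <- ga_supp f)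
    f c * (g (e - c) * t e)).
  by apply: eq_bigr => e _; rewrite convE mulr_suml; apply: eq_bigr => c _;
    rewrite mulrA.
rewrite exchange_big /= big_seq [RHS]big_seq; apply: eq_bigr => c hc.
rewrite -mulr_sumr; congr (_ * _).
rewrite -(fsbigTE _ (fun e => g (e - c) * t e)); last first.
  by move=> e /(sum_suppP hc) ->; rewrite mul0r.
rewrite (reindex_fsbigT (fun e => c + e)) /=; last first.
  by exists (fun e => e - c) => e; [rewrite addrC addKr|rewrite addrC subrK].
by apply: eq_fsbigr => e _; rewrite addrAC subrr add0r.
Qed.

Definition ga_zero := ga_mono 0 0.
Definition ga_one := ga_mono 1 0.
Definition ga_opp f := GroupAlg (ga_opp_finite f).
Definition ga_add f g := GroupAlg (ga_add_finite f g).
Definition ga_mul f g := GroupAlg (ga_mul_finite f g).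

Lemma ga_addA : associative ga_add.
Proof. by move=> f g h; apply: ga_eq => d; exact: addrA. Qed.

Lemma ga_addC : commutative ga_add.
Proof. by move=> f g; apply: ga_eq => d; exact: addrC. Qed.

Lemma ga_add0 : left_id ga_zero ga_add.
Proof. by move=> f; apply: ga_eq => d /=; case: ifP; rewrite add0r. Qed.

Lemma ga_addN : left_inverse ga_zero ga_opp ga_add.
Proof. by move=> f; apply: ga_eq => d /=; case: ifP; rewrite addNr. Qed.

Lemma ga_mulC : commutative ga_mul.
Proof.
move=> f g; apply: ga_eq => d; rewrite /= /conv.
rewrite (reindex_fsbigT (fun e => d - e)) /=; last first.
  by exists (fun e => d - e) => e; rewrite opprB addrC subrK.
by apply: eq_fsbigr => e _; rewrite mulrC opprB addrC subrK.
Qed.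

Lemma ga_mulA : associative ga_mul.
Proof.
move=> f g h; apply: ga_eq => d /=.
rewrite [RHS](conv_sum f g (fun e => h (d - e))) convE.
by apply: eq_bigr => c _; congr (_ * _); apply: eq_fsbigr => e _;
  rewrite opprD addrA.
Qed.

Lemma conv_mono (a : A) (c : D) (g : D -> A) d :
  conv (ga_mono a c) g d = a * g (d - c).
Proof.
rewrite /conv (fsbigTE [fset c]%fset); last first.
  by move=> e; rewrite inE /= => /negbTE ->; rewrite mul0r.
by rewrite big_seq_fset1 /= eqxx.
Qed.

Lemma ga_mul1 : left_id ga_one ga_mul.
Proof. by move=> f; apply: ga_eq => d /=; rewrite conv_mono mul1r subr0. Qed.

Lemma ga_mulDl : left_distributive ga_mul ga_add.
Proof.
move=> f g h; rewrite ga_mulC [ga_mul f h]ga_mulC [ga_mul g h]ga_mulC.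
apply: ga_eq => d /=; rewrite !convE -big_split /=.
by apply: eq_bigr => e _; rewrite mulrDr.
Qed.

HB.instance Definition _ :=
  GRing.isZmodule.Build groupAlg ga_addA ga_addC ga_add0 ga_addN.
HB.instance Definition _ := GRing.Zmodule_isComPzRing.Build groupAlg
  ga_mulA ga_mulC ga_mul1 ga_mulDl.

Lemma ga_monoM (a b : A) (c d : D) :
  ga_mono a c * ga_mono b d = ga_mono (a * b) (c + d).
Proof.
apply: ga_eq => e; rewrite [LHS]conv_mono /= subr_eq [d + c]addrC.
by case: ifP; rewrite ?mulr0.
Qed.

Definition ga_const (a : A) : groupAlg := ga_mono a 0.

Lemma ga_const_zmod : zmod_morphism ga_const.
Proof.
by move=> a b; apply: ga_eq => d; rewrite /GRing.add /GRing.opp /=;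
  case: ifP; rewrite ?oppr0 ?addr0.
Qed.

Lemma ga_const_monoid : monoid_morphism ga_const.
Proof. by split=> // a b; rewrite /ga_const ga_monoM addr0. Qed.

HB.instance Definition _ :=
  GRing.isZmodMorphism.Build A groupAlg ga_const ga_const_zmod.
HB.instance Definition _ :=
  GRing.isMonoidMorphism.Build A groupAlg ga_const ga_const_monoid.

End GroupAlgebra.

Section Coaction.
Variables (D : zmodType) (A : comPzRingType) (G : grading D A).

Definition component (a : A) : D -> A := projT1 (cid (piece_direct G a)).

Lemma componentP a : [/\ forall d, G d (component a d),
  finite_set [set d | component a d != 0]
  & a = \sum_(d \in setT) component a d].
Proof. by rewrite /component; case: (cid _) => c [/= ? _]. Qed.

Lemma component_uniq a (c : D -> A) : (forall d, G d (c d)) ->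
  finite_set [set d | c d != 0] -> a = \sum_(d \in setT) c d -> component a = c.
Proof.
by move=> h1 h2 h3; rewrite /component; case: (cid _) => c' [/= _ h]; exact: h.
Qed.

Lemma component_finite a : finite_set [set d | component a d != 0].
Proof. by case: (componentP a). Qed.

Definition coaction (a : A) : groupAlg A D := GroupAlg (component_finite a).

Lemma coaction_uniq a (c : groupAlg A D) : (forall d, G d (c d)) ->
  a = \sum_(d \in setT) c d -> coaction a = c.
Proof.
move=> h e; apply: ga_eq => d /=; rewrite (component_uniq h) //.
exact: ga_finite.
Qed.

Lemma coaction_sum a : a = \sum_(d \in setT) coaction a d.
Proof. by case: (componentP a). Qed.

Lemma coaction_piece a d : G d (coaction a d).
Proof. by case: (componentP a). Qed.

Lemma ga_sumE (c : groupAlg A D) (S : {fset D}) : (ga_supp c `<=` S)%fset ->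
  \sum_(d \in setT) c d = \sum_(d <- S) c d.
Proof.
move=> h; rewrite (fsbigTE S) // => d hd; apply: ga_suppP.
by apply: contra hd => /(fsubsetP h).
Qed.

Lemma coaction_zmod : zmod_morphism coaction.
Proof.
move=> a b; apply: coaction_uniq => [d|].
  by apply: pieceB; exact: coaction_piece.
rewrite {1}(coaction_sum a) {1}(coaction_sum b).
pose c := coaction a - coaction b.
pose S := (ga_supp (coaction a) `|` ga_supp (coaction b) `|` ga_supp c)%fset.
rewrite (@ga_sumE _ S); last by apply/fsubsetP => d hd; rewrite !inE hd.
rewrite (@ga_sumE (coaction b) S); last first.
  by apply/fsubsetP => d hd; rewrite !inE hd orbT.
rewrite (@ga_sumE c S); last by apply/fsubsetP => d hd; rewrite !inE hd orbT.
by rewrite -sumrB.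
Qed.

Lemma piece_sum d (I : eqType) (r : seq I) (F : I -> A) :
  (forall i, i \in r -> G d (F i)) -> G d (\sum_(i <- r) F i).
Proof.
elim: r => [|i r IH] h; first by rewrite big_nil; exact: piece0.
have hi : G d (F i) by apply: h; rewrite inE eqxx.
have hr : G d (\sum_(j <- r) F j).
  by apply: IH => j jr; apply: h; rewrite inE jr orbT.
rewrite big_cons -[X in _ + X]opprK; apply: pieceB => //.
by rewrite -sub0r; apply: pieceB => //; exact: piece0.
Qed.

Lemma coaction_monoid : monoid_morphism coaction.
Proof.
split; first apply: coaction_uniq => [d|] /=.
- by rewrite /=; case: eqP => [->|_]; [exact: piece1|exact: piece0].
- rewrite (fsbigTE [fset (0 : D)]%fset) ?big_seq_fset1 /= ?eqxx // => e.
  by rewrite inE => /negbTE ->.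
move=> a b; apply: coaction_uniq => [d|].
  rewrite [X in G d X]convE; apply: piece_sum => e _.
  have hd : e + (d - e) = d by rewrite addrC subrK.
  by rewrite -{1}hd; apply: pieceM; exact: coaction_piece.
have := conv_sum (coaction a) (coaction b) (fun=> 1).
under eq_fsbigr do rewrite mulr1.
move=> ->; under eq_bigr do under eq_fsbigr do rewrite mulr1.
rewrite -coaction_sum -mulr_suml; congr (_ * _).
by rewrite {1}(coaction_sum a); exact: ga_sumE.
Qed.

HB.instance Definition _ :=
  GRing.isZmodMorphism.Build A (groupAlg A D) coaction coaction_zmod.
HB.instance Definition _ :=
  GRing.isMonoidMorphism.Build A (groupAlg A D) coaction coaction_monoid.

Lemma coaction_homogeneous d a : G d a -> coaction a = ga_mono a d.
Proof.
move=> h; apply: coaction_uniq => [e|] /=.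
  by case: eqP => [->|_] //; exact: piece0.
rewrite (fsbigTE [fset d]%fset) ?big_seq_fset1 /= ?eqxx // => e.
by rewrite inE => /negbTE ->.
Qed.

End Coaction.

Section Proj.
Variables (D : zmodType) (A : comPzRingType) (G : grading D A).

(** [Spec A_0[D] x_(Spec A_0) Spec A = Spec A[D]], with action and second
    projection induced by the coaction and by the inclusion of constants. *)
Definition act_mor : rsMor (Spec (groupAlg A D)) (Spec A) :=
  Spec_map (coaction G : {rmorphism A -> groupAlg A D}).
Definition proj_mor : rsMor (Spec (groupAlg A D)) (Spec A) :=
  Spec_map (@ga_const A D : {rmorphism A -> groupAlg A D}).

Definition quotient_space : ringedSpace := coequalizer act_mor proj_mor.

Definition quotient_pi : rs_top (Spec A) -> rs_top quotient_space :=
  coeq_mor act_mor proj_mor.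

(** [quotient_pi] maps [D(f) = Spec A_f], which is stable under the action, onto
    the open subspace [Spec A_(f)] of the quotient when [f] is relevant. *)
Definition D_plus (f : A) : set (rs_top quotient_space) :=
  quotient_pi @` [set p : primeIdeal A | ~ p f].

Definition Proj_set : set (rs_top quotient_space) :=
  \bigcup_(f in relevant G) D_plus f.

Lemma coeq_rel_homogeneous f (p q : primeIdeal A) : homogeneous G f ->
  coeq_rel act_mor proj_mor p q -> (p f <-> q f).
Proof.
move=> [d hd]; elim=> {p q} [p q [z [-> ->]]|p|p q _|p q r _ + _].
- rewrite /= /preimage /= (coaction_homogeneous hd) /ga_const.
  case: (primeP z) => [[_ _ zM] _ _]; split=> h.
    by rewrite -[f]mul1r -(addNr d) -ga_monoM; exact: zM.
  by rewrite -[f]mul1r -[d]addr0 -ga_monoM; exact: zM.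
- by [].
- by move=> ->.
- by move=> -> ->.
Qed.

Lemma D_plus_open f : homogeneous G f -> open (D_plus f).
Proof.
move=> hf; rewrite /open /= /quotient_open.
exists [set f]; apply/seteqP; split=> p /=.
  move=> [q qf /eqmodP /asboolP h] /(_ f erefl) pf; apply: qf.
  exact/(coeq_rel_homogeneous hf h).
move=> h; exists p => // pf; apply: h => _ ->; exact: pf.
Qed.

Lemma Proj_set_open : open Proj_set.
Proof. by apply: bigcup_open => f [hf _]; exact: D_plus_open. Qed.

Definition Proj_MH : ringedSpace :=
  @open_subspace quotient_space (Opens Proj_set_open).

End Proj.

(* Main.v *)
Require Import Defs.
From mathcomp Require Import all_boot all_algebra.
From HB Require Import structures.
From Stdlib Require Import Relation_Operators.
From mathcomp Require Import all_classical finmap topology.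
From mathcomp Require Import ring.

(** Write [psi : A -> A[D]] for the coaction.  A section of the quotient near
    the image of a prime [p] is an invariant section of [Spec A], and
    invariance forces it to be a fraction [y / g] of homogeneous elements of
    the same degree with [g] outside [p].  Hence the stalk of the quotient is
    the subring of such fractions in the normal domain [A_p]; comparing
    homogeneous components, this subring is the intersection of [A_p] with the
    fraction field of the subring, so it is itself a normal domain.

    For the charts one needs that two primes with the same homogeneous elements
    are identified in the quotient, which amounts to the surjectivity of
    [Spec k[D] -> Spec B] for the coaction of a graded field [B] and a residue
    field [k].  If [f] is relevant, every homogeneous element has a multiple of
    degree in [Z deg f] with the same zeros on [D(f)]; therefore contraction to
    [A_(f)] separates exactly the points of the quotient, and the local rings
    of [A_(f)] embed into those of [A]. *)

Set Implicit Arguments.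
Unset Strict Implicit.
Unset Printing Implicit Defensive.

Import GRing.Theory.
Local Open Scope classical_set_scope.
Local Open Scope ring_scope.
Local Open Scope quotient_scope.

(** * Prime ideals and localization *)

Lemma inj_surj_bijective (T U : Type) (f : T -> U) :
  injective f -> (forall y, exists x, f x = y) -> bijective f.
Proof.
move=> finj /choice [g gK]; exists g => [x|//]; exact/finj/gK.
Qed.

Section Ideals.
Variable A : comPzRingType.
Implicit Types (I : set A) (p : primeIdeal A).

Lemma ideal_sub I a b : is_ideal I -> I a -> I b -> I (a - b).
Proof.
by move=> [_ ID IM] Ia Ib; apply: ID => //; rewrite -mulN1r; exact: IM.
Qed.

Lemma ideal_sum I (J : Type) (r : seq J) (F : J -> A) :
  is_ideal I -> (forall i, I (F i)) -> I (\sum_(i <- r) F i).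
Proof. by move=> [I0 ID _] h; apply: big_ind. Qed.

Lemma primeM p a b : p (a * b) <-> p a \/ p b.
Proof.
case: (Defs.primeP p) => [[_ _ pM] _ pP]; split; first exact: pP.
by case=> h; [rewrite mulrC|]; exact: pM.
Qed.

Lemma primeX p a n : p (a ^+ n) -> p a.
Proof.
elim: n => [|n IH]; first by rewrite expr0; case: (Defs.primeP p).
by rewrite exprS => /primeM [|/IH].
Qed.

Lemma prime_ideal p : is_ideal p. Proof. by case: (Defs.primeP p). Qed.

(** An ideal maximal among those containing [I] and disjoint from [M] is prime: if [a] and [b] lie
    outside it, both enlargements meet [M], and the product of the two elements found would lie in
    it as soon as [a * b] does. *)
Lemma prime_avoiding I (M : mulSet A) :
  is_ideal I -> (forall a, I a -> ~ M a) ->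
  exists p, (forall a, I a -> p a) /\ (forall a, p a -> ~ M a).
Proof.
move=> hI hM.
(* Taking the union with [I] lets the empty set satisfy [P], which covers the empty chain in Zorn's
   lemma. *)
pose P (J : set A) := is_ideal (J `|` I) /\ (forall a, (J `|` I) a -> ~ M a).
have P0 : P set0 by rewrite /P set0U.
have [F FP tot|Z [[Zid ZM] Zmax]] := @Zorn_bigcup _ P.
  have common a b : (\bigcup_(X in F) X `|` I) a -> (\bigcup_(X in F) X `|` I) b ->
      exists X, [/\ P X, X `<=` \bigcup_(X in F) X, (X `|` I) a & (X `|` I) b].
    move=> [[X FX Xa]|Ia] [[Y FY Yb]|Ib].
    - have [XY|YX] := tot X Y FX FY.
      + exists Y; split; [exact: FP|exact: bigcup_sup| |]; left=> //; exact: XY.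
      + exists X; split; [exact: FP|exact: bigcup_sup| |]; left=> //; exact: YX.
    - by exists X; split; [exact: FP|exact: bigcup_sup|left|right].
    - by exists Y; split; [exact: FP|exact: bigcup_sup|right|left].
    - by exists set0; split=> //; right.
  split; last by move=> a ha; have [X [[_ XM] _ Xa _]] := common a a ha ha; exact: XM.
  case: (hI) => I0 _ _; split; first by right.
    move=> a b ha hb; have [X [[[_ XD _] _] XF Xa Xb]] := common a b ha hb.
    by apply: (setSU XF); exact: XD.
  move=> a b hb; have [X [[[_ _ XM] _] XF Xb _]] := common b b hb hb.
  by apply: (setSU XF); exact: XM.
set q := Z `|` I in Zid ZM.
case: (Zid) => q0 qD qM.
have enlarge a : ~ q a -> exists y r, q y /\ M (y + r * a).
  move=> qa; apply: contrapT => hn.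
  pose B := [set x | exists y r, q y /\ x = y + r * a].
  have qB : q `<=` B by move=> y qy; exists y, 0; rewrite mul0r addr0.
  have BI : B `|` I = B.
    by apply/setUidPl => x Ix; apply: qB; right.
  apply: (Zmax B).
    split; first by move=> x Zx; apply: qB; left.
    move=> /(_ a) h; apply: qa; left; apply: h.
    by exists 0, 1; rewrite mul1r add0r.
  rewrite /P BI; split; last first.
    by move=> _ [y [r [qy ->]]] Mx; apply: hn; exists y, r.
  split; first exact: qB.
    move=> _ _ [y [r [qy ->]]] [y' [r' [qy' ->]]]; exists (y + y'), (r + r').
    by split; [exact: qD|ring].
  move=> c _ [y [r [qy ->]]]; exists (c * y), (c * r).
  by split; [exact: qM|ring].
have qprime : is_prime q.
  split=> // [h|a b qab]; first by apply: (ZM 1) => //; exact: mul_set1.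
  have [|qa] := pselect (q a); first by left.
  have [|qb] := pselect (q b); first by right.
  have [y [r [qy My]]] := enlarge a qa; have [x [s [qx Mx]]] := enlarge b qb.
  case: (ZM _ _ (mul_setM My Mx)).
  rewrite (_ : _ * _ = (x + s * b) * y + (r * a * x + r * s * (a * b))); last by ring.
  by apply: (qD); [|apply: (qD)]; exact: qM.
exists (PrimeIdeal qprime); split=> // a Ia; exact: (or_intror Ia).
Qed.

Lemma prime_avoiding_powers I g : is_ideal I -> (forall n, ~ I (g ^+ n)) ->
  exists p, (forall a, I a -> p a) /\ ~ p g.
Proof.
move=> hI hg; have [|p [pI pg]] := prime_avoiding (M := powers g) hI.
  by move=> a Ia [n e]; apply: (hg n); rewrite -e.
by exists p; split=> // /pg; apply; exists 1%N.
Qed.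

End Ideals.

(** * Fractions and maps out of a localization *)

Section LocalizationTheory.
Variables (A : comPzRingType) (S : mulSet A).

Lemma loc_fracB a s b t (hs : S s) (ht : S t) :
  loc_frac a hs - loc_frac b ht = loc_frac (a * t - b * s) (mul_setM hs ht).
Proof.
rewrite -[LHS]/(loc_add _ (loc_opp _)) loc_oppE loc_addE.
by apply: loc_eqW; ring.
Qed.

Lemma loc_fracM a s b t (hs : S s) (ht : S t) :
  loc_frac a hs * loc_frac b ht = loc_frac (a * b) (mul_setM hs ht).
Proof. exact: loc_mulE. Qed.

Lemma loc_inj_zmod : zmod_morphism (loc_inj S).
Proof. by move=> a b; rewrite loc_fracB; apply: loc_eqW; ring. Qed.

Lemma loc_inj_monoid : monoid_morphism (loc_inj S).
Proof. by split=> // a b; rewrite loc_fracM; apply: loc_eqW; ring. Qed.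

HB.instance Definition _ := GRing.isZmodMorphism.Build A (loc S) (loc_inj S)
  loc_inj_zmod.
HB.instance Definition _ := GRing.isMonoidMorphism.Build A (loc S) (loc_inj S)
  loc_inj_monoid.

Lemma loc_inj_eq0 a : loc_inj S a = 0 <-> exists2 u, S u & u * a = 0.
Proof.
split.
  by move/loc_eq => [u Su]; rewrite mulr1 mul0r mulr0 => e; exists u.
by move=> [u Su e]; apply/loc_eq; exists u; rewrite // mulr1 mul0r mulr0.
Qed.

Lemma loc_inj_eq a b : loc_inj S a = loc_inj S b <-> exists2 u, S u & u * a = u * b.
Proof.
split=> [/loc_eq|[u Su e]]; first by rewrite !mulr1.
by apply/loc_eq; exists u; rewrite // !mulr1.
Qed.

Lemma loc_den_mul a s (hs : S s) : loc_inj S s * loc_frac a hs = loc_inj S a.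
Proof. by rewrite loc_fracM; apply: loc_eqW; ring. Qed.

Lemma loc_inj_unit s : S s -> exists r, loc_inj S s * r = 1.
Proof. by move=> hs; exists (loc_frac 1 hs); rewrite loc_den_mul. Qed.

Lemma loc_inj_cancel s x y : S s -> loc_inj S s * x = loc_inj S s * y -> x = y.
Proof.
move=> /loc_inj_unit [r e] h.
by rewrite -[x]mul1r -[y]mul1r -e ![_ * r]mulrC -!mulrA h.
Qed.

Lemma loc_fracE a s (hs : S s) x :
  x = loc_frac a hs <-> loc_inj S s * x = loc_inj S a.
Proof.
split=> [->|h]; first exact: loc_den_mul.
by apply: (loc_inj_cancel hs); rewrite h loc_den_mul.
Qed.

End LocalizationTheory.

Lemma loc_map_inj (A B : comPzRingType) (phi : {rmorphism A -> B})
    (S : mulSet A) (T : mulSet B) (hST : forall s, S s -> T (phi s)) a :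
  loc_map hST (loc_inj S a) = loc_inj T (phi a).
Proof. by rewrite /loc_inj loc_mapE; apply: loc_eqW; rewrite rmorph1. Qed.

Section LocalizationLift.
Variables (A B : comPzRingType) (theta : {rmorphism A -> B}) (S : mulSet A).
Hypothesis theta_unit : forall s, S s -> exists r, theta s * r = 1.

(** The universal property of localization, with a chosen inverse of the image of the denominator;
    [loc_lift_frac] characterizes the value on any representative. *)
Definition loc_lift (x : loc S) : B :=
  theta (loc_num x) * projT1 (cid (theta_unit (loc_denP x))).

Lemma loc_lift_cancel s x y : S s -> theta s * x = theta s * y -> x = y.
Proof.
move=> /theta_unit [r e] h.
by rewrite -[x]mul1r -[y]mul1r -e ![_ * r]mulrC -!mulrA h.
Qed.

Lemma loc_lift_frac a s (hs : S s) : theta s * loc_lift (loc_frac a hs) = theta a.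
Proof.
rewrite /loc_lift; case: (cid _) => r /= e.
have [u hu e'] := (loc_eq _ _ _ _).1 (loc_fracK (loc_frac a hs)).
apply: (loc_lift_cancel (mul_setM hu (loc_denP (loc_frac a hs)))).
transitivity (theta (u * (loc_num (loc_frac a hs) * s))
   * (theta (loc_den (loc_frac a hs)) * r)); first by rewrite !rmorphM; ring.
by rewrite e -e' !rmorphM; ring.
Qed.

Lemma loc_lift_zmod : zmod_morphism loc_lift.
Proof.
move=> x y; have [a [s [hs ->]]] := loc_fracP x; have [b [t [ht ->]]] := loc_fracP y.
rewrite loc_fracB; apply: (loc_lift_cancel (mul_setM hs ht)).
rewrite loc_lift_frac mulrBr rmorphM mulrAC loc_lift_frac.
by rewrite -mulrA loc_lift_frac rmorphB !rmorphM; ring.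
Qed.

Lemma loc_lift_monoid : monoid_morphism loc_lift.
Proof.
split=> [|x y].
  by apply: (loc_lift_cancel (mul_set1 S)); rewrite loc_lift_frac rmorph1 mul1r.
have [a [s [hs ->]]] := loc_fracP x; have [b [t [ht ->]]] := loc_fracP y.
rewrite loc_fracM; apply: (loc_lift_cancel (mul_setM hs ht)).
by rewrite loc_lift_frac [theta (s * t)]rmorphM mulrACA !loc_lift_frac rmorphM.
Qed.

HB.instance Definition _ :=
  GRing.isZmodMorphism.Build (loc S) B loc_lift loc_lift_zmod.
HB.instance Definition _ :=
  GRing.isMonoidMorphism.Build (loc S) B loc_lift loc_lift_monoid.

End LocalizationLift.

(** The last hypothesis says that [R] is the intersection of [N] with the total
    ring of fractions of [R]. *)
Lemma normal_domain_sub (R N : comPzRingType) (eps : {rmorphism R -> N}) :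
  injective eps -> normal_domain N ->
  (forall r s y, s <> 0 -> eps r = eps s * y -> exists t, r = s * t) ->
  normal_domain R.
Proof.
move=> einj [N1 ND NI] sat.
have e0 a : eps a = 0 -> a = 0 by rewrite -(rmorph0 eps) => /einj.
have R1 : (1 : R) <> 0 by move=> /(congr1 eps); rewrite rmorph1 rmorph0.
split=> //.
  move=> a b /(congr1 eps); rewrite rmorphM rmorph0 => /ND.
  by case=> /e0; [left|right].
have nz s : nonzerodivisors R s -> s <> 0.
  by move=> h s0; apply: R1; apply: h; rewrite s0 mul0r.
have hT s : nonzerodivisors R s -> nonzerodivisors N (eps s).
  by move=> h a /ND [/e0|//] => /(nz _ h).
move=> x [n [c e]]; have [r [s [hs xE]]] := loc_fracP x.
(* The integral equation of [x] maps to one for its image, which is therefore an element [y] of [N].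
   Then [eps r = eps s * y], and the last hypothesis divides [r] by [s] inside [R]. *)
have [|y hy] := NI (loc_map hT x).
  exists n, (eps \o c).
  rewrite -[RHS](rmorph0 (loc_map hT)) -e rmorphD rmorphXn rmorph_sum.
  congr (_ + _); apply: eq_bigr => i _ /=.
  by rewrite rmorphM rmorphXn /= loc_map_inj.
have ns := nz _ hs.
have [|t rE] := sat r s y ns.
  move: hy; rewrite xE loc_mapE => /loc_eq [u hu].
  rewrite mulr1 => h; rewrite [RHS]mulrC; apply/eqP; rewrite -subr_eq0; apply/eqP.
  by apply: hu; rewrite mulrBr h subrr.
by exists t; rewrite xE; apply: loc_eqW; rewrite rE; ring.
Qed.

Lemma normal_locE (A : comPzRingType) (p : primeIdeal A) (a b : A) :
  normal_ring A ->
  loc_inj (prime_compl p) a * loc_inj (prime_compl p) b = 0 ->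
  loc_inj (prime_compl p) a = 0 \/ loc_inj (prime_compl p) b = 0.
Proof. by move=> /(_ p) [_ h _]; exact: h. Qed.

(** Otherwise some prime contains the annihilator of [w] and misses [g], while the vanishing of [w]
    at that prime yields an annihilator outside it. *)
Lemma locally_zero_power (A : comPzRingType) (g w : A) :
  (forall p : primeIdeal A, ~ p g -> loc_inj (prime_compl p) w = 0) ->
  exists m, g ^+ m * w = 0.
Proof.
move=> h; apply: contrapT => hn.
have [||p [pI pg]] := @prime_avoiding_powers A [set a | a * w = 0] g.
- split=> [|a b|a b] /=; rewrite ?mul0r // ?mulrDl.
    by move=> -> ->; rewrite addr0.
  by rewrite -mulrA => ->; rewrite mulr0.
- by move=> m /= e; apply: hn; exists m.
by have /loc_inj_eq0 [u pu /pI] := h p pg.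
Qed.

(** * Primes with the same homogeneous elements *)

Lemma prime_ext (A : comPzRingType) (p q : primeIdeal A) :
  (forall a, p a <-> q a) -> p = q.
Proof. by move=> h; apply/prime_eq/funext => a; apply/propext. Qed.

Section GroupAlgebraIdeals.
Variables (A : comPzRingType) (D : zmodType).
Implicit Types (g h : groupAlg A D) (I : set A).

Lemma ga_mono_mulE (a : A) (c : D) g d : (ga_mono a c * g) d = a * g (d - c).
Proof. exact: conv_mono. Qed.

Lemma ga_big_sumE (J : Type) (r : seq J) (F : J -> groupAlg A D) d :
  (\sum_(i <- r) F i) d = \sum_(i <- r) F i d.
Proof.
apply: (big_morph (fun g : groupAlg A D => g d)) => //=.
by case: ifP.
Qed.

Lemma ga_mono_sum g : g = \sum_(d <- ga_supp g) ga_mono (g d) d.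
Proof.
apply: ga_eq => e; rewrite ga_big_sumE /=.
have [he|he] := boolP (e \in ga_supp g); last first.
  rewrite big_seq big1 ?(ga_suppP he) // => d hd.
  by case: eqP hd he => // <- ->.
rewrite (big_fsetD1 e he) /= eqxx big_seq big1 ?addr0 // => d.
by rewrite !inE eq_sym => /andP [/negbTE ->].
Qed.

Definition ga_ideal I : set (groupAlg A D) := [set g | forall d, I (g d)].

Lemma ga_ideal_ideal I : is_ideal I -> is_ideal (ga_ideal I).
Proof.
move=> hI; case: (hI) => I0 ID IM; split.
- by move=> d /=; case: ifP.
- by move=> g h Ig Ih d; exact: ID.
- move=> g h Ih d; rewrite [X in I X]convE; apply: ideal_sum => // e; exact: IM.
Qed.

End GroupAlgebraIdeals.

Section Graded.
Variables (D : zmodType) (A : comPzRingType) (G : grading D A).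
Implicit Types (p q r : primeIdeal A) (z : primeIdeal (groupAlg A D)).
Local Notation psi := (coaction G).

Lemma coactionM d c a e : G d c -> psi (c * a) e = c * psi a (e - d).
Proof.
move=> h; have -> : psi (c * a) = psi c * psi a by exact: rmorphM.
by rewrite (coaction_homogeneous h) ga_mono_mulE.
Qed.

Lemma coactionB a b d : psi (a - b) d = psi a d - psi b d.
Proof. by have -> : psi (a - b) = psi a - psi b by exact: rmorphB. Qed.

Lemma coaction0 : psi 0 = 0.
Proof. exact: rmorph0. Qed.

Lemma pieceD d a b : G d a -> G d b -> G d (a + b).
Proof.
move=> Ga Gb; rewrite -[b]opprK; apply: pieceB => //.
by rewrite -sub0r; apply: pieceB => //; exact: piece0.
Qed.

Lemma ideal_coaction (I : set A) a : is_ideal I -> (forall d, I (psi a d)) -> I a.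
Proof.
move=> hI h; rewrite (coaction_sum G a) (@ga_sumE _ _ _ (ga_supp (psi a))) //.
exact: ideal_sum.
Qed.

Lemma prime_component p a : ~ p a -> exists d, ~ p (psi a d).
Proof.
move=> pa; apply: contrapT => hn; apply: pa; apply: ideal_coaction.
  exact: prime_ideal.
by move=> d; apply: contrapT => pd; apply: hn; exists d.
Qed.

Lemma pieceX d a n : G d a -> G (d *+ n) (a ^+ n).
Proof.
move=> h; elim: n => [|n IH]; first by rewrite mulr0n; exact: piece1.
by rewrite mulrS exprS; exact: pieceM.
Qed.

(** Gaussian elimination: the first term of the relation is eliminated with a
    homogeneous component [c] of [a] outside [q]. When [A] is a graded field
    this replaces the fact that graded [A]-modules are free. *)
Lemma relation_descent p q : (forall d a, G d a -> p a -> q a) ->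
    (forall d a, G d a -> q a -> p a) ->
  forall (r : seq (A * A * D)) s t, {in r, forall x, p x.1.1} -> ~ q t ->
  (forall d, q (psi s d * t - \sum_(x <- r) psi x.1.1 (d - x.2) * x.1.2)) -> p s.
Proof.
move=> pq qp r; have [n] := ubnP (size r).
elim: n r => // n IH [|[[a b] d0] r] hn s t pr qt hq.
  apply: ideal_coaction => [|d]; first exact: prime_ideal.
  apply: (qp d); first exact: coaction_piece.
  by have := hq d; rewrite big_nil subr0 => /primeM [].
have pa : p a by apply: (pr (a, b, d0)); rewrite inE eqxx.
have pr' : {in r, forall x, p x.1.1} by move=> x xr; apply: pr; rewrite inE xr orbT.
have qid := prime_ideal q; case: (qid) => _ qD qM.
pose E d := psi s d * t - \sum_(x <- (a, b, d0) :: r) psi x.1.1 (d - x.2) * x.1.2.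
have EE d : psi s d * t - \sum_(x <- r) psi x.1.1 (d - x.2) * x.1.2 =
    E d + psi a (d - d0) * b by rewrite /E big_cons /=; ring.
(* If all components of [a] lie in [q], this term vanishes modulo [q] and is dropped. *)
have [qa|/existsNP [e qc]] := pselect (forall e, q (psi a e)).
  apply: (IH r _ s t) => // d; rewrite EE.
  by apply: qD; [exact: hq|rewrite mulrC; exact: qM].
set c := psi a e in qc; have Gc : G e c by exact: coaction_piece.
set u := e + d0.
(* The pivot [c] is homogeneous and outside [q], hence outside [p], while [a] lies in [p]; so [s]
   may be replaced by this combination. *)
suff : p (c * s - psi s u * a).
  move=> ps'; have /primeM [pc|//] : p (c * s).
    case: (prime_ideal p) => _ pD pM.
    by rewrite -(subrK (psi s u * a) (c * s)); apply: pD => //; exact: pM.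
  by case: qc; exact: pq Gc pc.
pose F x := (c * x.1.1 - psi x.1.1 (u - x.2) * a, x.1.2, x.2) : A * A * D.
apply: (IH [seq F x | x <- r] _ _ t) => //.
- by rewrite size_map.
- move=> _ /mapP [x xr ->] /=; apply: ideal_sub; first exact: prime_ideal.
    by case: (prime_ideal p) => _ _; apply; exact: pr'.
  by case: (prime_ideal p) => _ _; exact.
move=> d; rewrite big_map /=.
(* In degrees [d - e] and [u] the coefficients of [b] are [psi a (d - u)] and [c] up to sign, so
   this combination of the two relations cancels [b]. *)
suff -> : psi (c * s - psi s u * a) d * t - \sum_(x <- r)
    psi (c * x.1.1 - psi x.1.1 (u - x.2) * a) (d - x.2) * x.1.2 =
  c * E (d - e) - psi a (d - u) * E u.
  by apply: ideal_sub => //; apply: qM; exact: hq.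
transitivity (c * (psi s (d - e) * t - \sum_(x <- r) psi x.1.1 (d - e - x.2) * x.1.2)
  - psi a (d - u) * (psi s u * t - \sum_(x <- r) psi x.1.1 (u - x.2) * x.1.2)).
  rewrite coactionB (coactionM _ _ Gc) (coactionM _ _ (coaction_piece G s u)).
  rewrite (eq_bigr (fun x => c * (psi x.1.1 (d - e - x.2) * x.1.2) -
    psi a (d - u) * (psi x.1.1 (u - x.2) * x.1.2))); last first.
    move=> x _; rewrite coactionB (coactionM _ _ Gc).
    rewrite (coactionM _ _ (coaction_piece G _ _)).
    have -> : d - x.2 - (u - x.2) = d - u by rewrite opprB addrA subrK.
    by rewrite (addrAC d); ring.
  by rewrite sumrB -!mulr_sumr; ring.
rewrite !EE; have -> : u - d0 = e by rewrite addrK.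
have -> : d - e - d0 = d - u by rewrite /u opprD addrA.
by rewrite -/c; ring.
Qed.

(** The prime [z] is a point that the action maps to [p] and the projection to [q]. It has to
    contain [psi p] and the extension of [q], and to avoid every [psi s * ga_const D t] with [s]
    outside [p] and [t] outside [q]; [relation_descent] shows these demands to be compatible. *)
Lemma same_homogeneous p q : (forall d a, G d a -> p a <-> q a) ->
  exists z, comap psi z = p /\ comap (@ga_const A D) z = q.
Proof.
move=> pq.
(* The ideal generated by [psi p] and the extension of [q]; each triple holds an element of [p], a
   coefficient and a degree. *)
pose J : set (groupAlg A D) := [set g | exists2 r : seq (A * A * D),
  {in r, forall x, p x.1.1} &
  ga_ideal q (g - \sum_(x <- r) psi x.1.1 * ga_mono x.1.2 x.2)].
have [Q0 QD QM] := ga_ideal_ideal D (prime_ideal q).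
have J0 : J 0 by exists [::] => //; rewrite big_nil subr0.
have JD g h : J g -> J h -> J (g + h).
  move=> [r pr hr] [s ps hs]; exists (r ++ s).
    by move=> x; rewrite mem_cat => /orP [/pr|/ps].
  by rewrite big_cat /= opprD addrACA; exact: QD.
have Jmono a d h : J h -> J (ga_mono a d * h).
  move=> [r pr hr]; exists [seq (x.1.1, a * x.1.2, d + x.2) | x <- r].
    by move=> _ /mapP [x xr ->] /=; exact: pr.
  rewrite big_map /= (eq_bigr (fun x => ga_mono a d * (psi x.1.1 * ga_mono x.1.2 x.2))).
    by rewrite -mulr_sumr -mulrBr; exact: QM.
  by move=> x _; rewrite mulrCA ga_monoM.
have Jid : is_ideal J.
  split=> // g h Jh; rewrite (ga_mono_sum g) mulr_suml.
  by apply: big_ind => // d _; exact: Jmono.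
pose M : set (groupAlg A D) := [set g | exists s t,
  [/\ ~ p s, ~ q t & g = psi s * ga_const D t]].
have M1 : M 1.
  exists 1, 1; rewrite !rmorph1 mulr1.
  by split=> //; [case: (Defs.primeP p)|case: (Defs.primeP q)].
have MM g h : M g -> M h -> M (g * h).
  move=> [s [t [ps qt ->]]] [s' [t' [ps' qt' ->]]]; exists (s * s'), (t * t').
  by split; [move=> /primeM []|move=> /primeM []|rewrite !rmorphM mulrACA].
have [g [r pr hr] [s [t [ps qt gE]]]|z [zJ zM]] :=
    prime_avoiding (M := MulSet M1 MM) Jid.
  apply: ps; apply: (relation_descent _ _ pr qt).
  - by move=> d a /pq [].
  - by move=> d a /pq [].
  move=> d; have := hr d; rewrite gE.
  rewrite [X in q X](_ : _ =
    psi s d * t - \sum_(x <- r) psi x.1.1 (d - x.2) * x.1.2) //.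
  rewrite [psi s * _]mulrC; set S := \sum_(x <- r) (_ * ga_mono _ _).
  transitivity ((ga_const D t * psi s) d - S d); first by [].
  rewrite ga_mono_mulE subr0 mulrC ga_big_sumE; congr (_ - _).
  by apply: eq_bigr => x _; rewrite mulrC ga_mono_mulE mulrC.
exists z; split; apply: prime_ext => a; split.
- move=> za; apply: contrapT => pa; apply: (zM _ za).
  exists a, 1; split=> //; first by case: (Defs.primeP q).
  by rewrite rmorph1 mulr1.
- move=> pa; apply: zJ; exists [:: (a, 1, 0)].
    by move=> x; rewrite inE => /eqP ->.
  by rewrite big_cons big_nil /= addr0 mulr1 subrr.
- move=> za; apply: contrapT => qa; apply: (zM _ za).
  exists 1, a; split=> //; first by case: (Defs.primeP p).
  by rewrite rmorph1 mul1r.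
- move=> qa; apply: zJ; exists [::] => //; rewrite big_nil subr0 => d /=.
  by case: ifP => // _; case: (prime_ideal q).
Qed.

(** Let [I] be the ideal of elements vanishing off [U]. If its homogeneous elements all lay in [p],
    some prime [z] would contain the extension of [I] and have its image under the action contained
    in [p]. The projection of [z] is outside [U], hence by saturation so is that image, and then [p]
    too would be outside [U]. *)
Lemma saturated_open_homogeneous (U : set (primeIdeal A)) p : open U ->
    (forall z, U (comap psi z) <-> U (comap (@ga_const A D) z)) -> U p ->
  exists h, [/\ homogeneous G h, ~ p h & forall r, ~ r h -> U r].
Proof.
move=> [E UE] sat Up; apply: contrapT => hn.
pose I : set A := [set a | forall r, ~ U r -> r a].
have hI : is_ideal I.
  split=> [r _|a b ha hb r Ur|a b hb r Ur]; case: (prime_ideal r) => r0 rD rM //.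
    by apply: rD; [exact: ha|exact: hb].
  by apply: rM; exact: hb.
have Ip d a : G d a -> I a -> p a.
  move=> Ga Ia; apply: contrapT => pa; apply: hn; exists a; split=> //.
    by exists d.
  by move=> r ra; apply: contrapT => /Ia.
pose M : set (groupAlg A D) := [set g | exists2 s, ~ p s & g = psi s].
have M1 : M 1 by exists 1; rewrite ?rmorph1 //; case: (Defs.primeP p).
have MM g h : M g -> M h -> M (g * h).
  by move=> [s ps ->] [t pt ->]; exists (s * t); [move=> /primeM []|rewrite rmorphM].
have [g hg [s ps gE]|z [zI zM]] :=
    prime_avoiding (M := MulSet M1 MM) (ga_ideal_ideal D hI).
  apply: ps; apply: ideal_coaction => [|d]; first exact: prime_ideal.
  by apply: (Ip d); [exact: coaction_piece|rewrite -gE; exact: hg].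
have EI a : E a -> I a.
  by move=> Ea r; rewrite UE => /contrapT; exact.
have hproj : ~ U (comap (@ga_const A D) z).
  rewrite {1}UE /=; apply=> a /EI Ia; apply: zI => d /=.
  by case: ifP => // _; case: hI.
have : ~ U (comap psi z) by move=> /sat.
rewrite {1}UE /= => /contrapT Ez; move: Up; rewrite UE; apply=> a /Ez za.
by apply: contrapT => pa; apply: (zM _ za); exists a.
Qed.

(** * Degrees of units when [f] is relevant *)

Lemma homogeneous_degree d e a : G d a -> G e a -> d = e \/ a = 0.
Proof.
move=> Gd Ge; have [|de] := eqVneq d e; first by left.
right; have := coaction_homogeneous Ge; rewrite (coaction_homogeneous Gd).
by move=> /(congr1 (fun g : groupAlg A D => g d)) /=; rewrite eqxx (negbTE de).
Qed.

(** Up to multiples of [e], some positive multiple of [d] is the degree of a homogeneous unit of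
    [A_f]: unit degrees have finite index, so the pigeonhole principle applies to the multiples of
    [d]. *)
Lemma relevant_degree f e : relevant G f -> G e f -> forall d, exists N m k c j,
  [/\ (0 < N)%N, G (e *+ m - d *+ N) k & c * k = f ^+ j].
Proof.
move=> [_ [r hr]] Gf d.
(* For [f = 0] the degree occurring in [loc_piece] need not be [e], but [k = 0] works. *)
have [f0|f0] := eqVneq f 0.
  by exists 1%N, 0%N, 0, 0, 1%N; rewrite f0 mul0r; split=> //; exact: piece0.
(* Modulo multiples of [e], both [x] and [- x] are degrees of factors of one power of [f]; this
   expresses a unit and its inverse without fractions. *)
pose H x := exists n m a b c j,
  [/\ G (e *+ n + x) a, G (e *+ m - x) b & c * a * b = f ^+ j].
have HB x y : H x -> H y -> H (x - y).
  move=> [n [m [a [b [c [j [Ga Gb E]]]]]]] [n' [m' [a' [b' [c' [j' [Ga' Gb' E']]]]]]].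
  exists (n + m')%N, (m + n')%N, (a * b'), (b * a'), (c * c'), (j + j')%N; split.
  - by rewrite mulrnDr addrACA; exact: pieceM.
  - by rewrite mulrnDr opprB [y - x]addrC addrACA; exact: pieceM.
  - by rewrite exprD -E -E'; ring.
have Hunit x : (exists2 g, @loc_piece D A G f x g & exists h, g * h = 1) -> H x.
  move=> [_ [e' [n [a [hf [Gf' Ga ->]]]]] [h]].
  have [E|/eqP] := homogeneous_degree Gf' Gf; last by rewrite (negbTE f0).
  rewrite {}E {e' Gf'} in Ga; have [b [s [hs ->]]] := loc_fracP h.
  have [m sE] := hs; rewrite loc_fracM => /loc_eq [_ [l ->]].
  rewrite sE mulr1 mul1r -!exprD => E.
  have Gl : G (e *+ l + (x + e *+ n)) (f ^+ l * a).
    by apply: pieceM => //; exact: pieceX.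
  exists n, m, a, (psi b (e *+ m - x)), (f ^+ l), (l + (n + m))%N; split.
  - by rewrite addrC.
  - exact: coaction_piece.
  have := coactionM b (e *+ (l + (n + m))) Gl.
  rewrite -mulrA E (coaction_homogeneous (pieceX _ Gf)) /= eqxx => ->.
  congr (_ * psi b _); rewrite !mulrnDr opprD addrACA subrr add0r.
  by rewrite [x + _]addrC opprD addrACA subrr add0r.
have /choice [x hx] i : exists x, x \in r /\ H (d *+ i - x).
  by have [x xr /Hunit] := hr (d *+ i); exists x.
(* Among the [(size r).+1] multiples [d *+ i] with [i] at most [size r], two share a coset
   representative; their difference gives [N = j - i]. *)
have /uniqPn : ~~ uniq [seq x i | i <- iota 0 (size r).+1].
  apply/negP => /uniq_leq_size; rewrite size_map size_iota => /(_ r).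
  have sub : {subset [seq x i | i <- iota 0 (size r).+1] <= r}.
    by move=> _ /mapP [i _ ->]; have [] := hx i.
  by move=> /(_ sub); rewrite ltnn.
move=> /(_ 0) [i [j [ij]]]; rewrite size_map size_iota => js.
rewrite !(nth_map 0%N) ?size_iota ?nth_iota // ?(ltn_trans ij) // !add0n => xij.
have [_ hi] := hx i; have [_ hj] := hx j.
have := HB _ _ hj hi; rewrite xij opprB addrA subrK -mulrnBr; last exact: ltnW.
move=> [n [m [a [b [c [l [_ Gb E]]]]]]].
by exists (j - i)%N, m, b, (c * a), l; rewrite subn_gt0.
Qed.

End Graded.

(** * Sections of the quotient *)

Lemma normal_locX (A : comPzRingType) (p : primeIdeal A) (a : A) n :
  normal_ring A -> loc_inj (prime_compl p) (a ^+ n) = 0 ->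
  loc_inj (prime_compl p) a = 0.
Proof.
move=> hA; elim: n => [|n IH]; rewrite ?exprS.
  by case: (hA p) => h _ _; rewrite rmorph1 => /h.
by rewrite rmorphM => /(normal_locE hA) [|/IH].
Qed.

Lemma zariski_basis (A : comPzRingType) (U : opens (primeIdeal A)) p :
  U p -> exists k, ~ p k /\ forall r : primeIdeal A, ~ r k -> U r.
Proof.
have [E UE] := opensP U; rewrite [X in X -> _](_ : _ = ~ (E `<=` p)); last first.
  exact: (congr1 (fun S : set _ => S p) UE).
move=> /existsNP [k /not_implyP [Ek pk]]; exists k; split=> // r rk.
rewrite (_ : U r = ~ (E `<=` r)); first by move=> /(_ k Ek).
exact: (congr1 (fun S : set _ => S r) UE).
Qed.

(** No quasi-compactness is needed: a section vanishing on [D(k)] is killed by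
    [k], because in each local domain either [k] or the section is zero. *)
Lemma section_fraction (A : comPzRingType) (hA : normal_ring A)
    (U : opens (primeIdeal A)) (s : spec_sec U) (h : A) :
  (forall r : primeIdeal A, ~ r h -> U r) ->
  exists N y, forall r (Ur : U r), ~ r h ->
    loc_inj (prime_compl r) (h ^+ N) * s r Ur = loc_inj (prime_compl r) y.
Proof.
move=> hU.
pose J : set A := [set x | exists y, forall r (Ur : U r), ~ r h ->
  loc_inj (prime_compl r) x * s r Ur = loc_inj (prime_compl r) y].
have hJ : is_ideal J.
  split.
  - by exists 0 => r Ur _; rewrite rmorph0 mul0r.
  - move=> a b [y hy] [y' hy']; exists (y + y') => r Ur rh.
    by rewrite !rmorphD mulrDl hy ?hy'.
  - move=> a b [y hy]; exists (a * y) => r Ur rh.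
    by rewrite !rmorphM -mulrA hy.
apply: contrapT => hn.
have [|p [pJ ph]] := @prime_avoiding_powers A J h hJ.
  by move=> N [y hy]; apply: hn; exists N, y.
have [V [hV [a [b [Vp e]]]]] := secP s (hU p ph).
have [k [pk kV]] := zariski_basis Vp.
have [pb _] := e p Vp.
(* The fraction [a / b] represents [s] on [D(k)]. Multiplying by [k] extends the identity to all of
   [D(h)], although [k * b] is outside [p]. *)
suff /pJ /primeM [|] : J (k * b) by [].
exists (k * a) => q Uq qh.
have [V' [hV' [a' [b' [Vq e']]]]] := secP s Uq.
have [k' [qk' kV']] := zariski_basis Vq.
have [|m hm] := @locally_zero_power A (k * k') (a * b' - a' * b).
  move=> r /primeM rkk'; have Vr : V r by apply: kV => rk; apply: rkk'; left.
  have Vr' : V' r by apply: kV' => rk; apply: rkk'; right.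
  have [rb /loc_fracE E] := e r Vr; have [rb' /loc_fracE E'] := e' r Vr'.
  rewrite rmorphB !rmorphM /= -E -E'; set t := s r _; set t' := s r _.
  by rewrite (_ : t' = t); [ring|congr (s r _); exact: Prop_irrelevance].
have [qb' /loc_fracE E] := e' q Vq; rewrite (Prop_irrelevance (hV' q Vq) Uq) in E.
apply: (loc_inj_cancel qb'); rewrite mulrCA E !rmorphM /=.
apply/eqP; rewrite -subr_eq0; apply/eqP.
(* In the local domain at [q], either the power of [k * k'] vanishes, and then so does [k] because
   [k'] is a unit there, or the difference of the cross products vanishes. *)
have /(normal_locE hA) [/(normal_locX hA)|w0] :
    loc_inj (prime_compl q) ((k * k') ^+ m) *
    loc_inj (prime_compl q) (a * b' - a' * b) = 0.
  by rewrite -rmorphM hm rmorph0.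
  rewrite mulrC rmorphM => k0.
  have -> : loc_inj (prime_compl q) k = 0.
    by apply: (@loc_inj_cancel _ (prime_compl q) k') => //; rewrite k0 mulr0.
  by rewrite !mul0r mulr0 subr0.
transitivity (- (loc_inj (prime_compl q) k *
                 loc_inj (prime_compl q) (a * b' - a' * b))).
  by rewrite rmorphB !rmorphM; ring.
by rewrite w0 mulr0 oppr0.
Qed.

Section Quotient.
Variables (D : zmodType) (A : comPzRingType) (G : grading D A).
Implicit Types (p q r : primeIdeal A) (z : primeIdeal (groupAlg A D)).
Local Notation psi := (coaction G).
Local Notation Q := (quotient_space G).
Local Notation pi := (quotient_pi G).

(** Membership of homogeneous elements is constant on classes; conversely a single point of [Spec
    A[D]] already relates [p] and [q]. *)
Lemma quotient_pi_eq p q :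
  pi p = pi q <-> forall a, homogeneous G a -> (p a <-> q a).
Proof.
split=> [/eqmodP /asboolP h a ha|h].
  exact: (coeq_rel_homogeneous ha h).
have [|z [<- <-]] := @same_homogeneous D A G p q.
  by move=> d a Ga; apply: h; exists d.
exact: (coeq_pi_eq (act_mor G) (proj_mor D A)).
Qed.

Lemma quotient_pi_surj (x : rs_top Q) : exists p, pi p = x.
Proof. by exists (repr x); exact: reprK. Qed.

Lemma homogeneous_nbhd (O : opens (rs_top Q)) p : O (pi p) ->
  exists h, [/\ homogeneous G h, ~ p h & forall r, ~ r h -> O (pi r)].
Proof.
move=> Op; apply: (@saturated_open_homogeneous _ _ G (pi @^-1` O)) => //.
  exact: opensP (opens_preim (coeq_pi_cont (f:=act_mor G) (g:=proj_mor D A)) O).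
move=> z; rewrite /preimage /=.
by rewrite (_ : pi (comap psi z) = pi (comap (@ga_const A D) z)) //;
  exact: (coeq_pi_eq (act_mor G) (proj_mor D A)).
Qed.

Section Values.
Variables (O : opens (rs_top Q)).

Definition secval p (Op : O (pi p)) (s : rs_sec O) : loc (prime_compl p) :=
  sec_fun (coeq_incl s : spec_sec _) Op.

Lemma secval_zmod p (Op : O (pi p)) : zmod_morphism (secval Op).
Proof. by []. Qed.

Lemma secval_monoid p (Op : O (pi p)) : monoid_morphism (secval Op).
Proof. by []. Qed.

HB.instance Definition _ p (Op : O (pi p)) := GRing.isZmodMorphism.Build
  (rs_sec O) (loc (prime_compl p)) (secval Op) (secval_zmod Op).
HB.instance Definition _ p (Op : O (pi p)) := GRing.isMonoidMorphism.Build
  (rs_sec O) (loc (prime_compl p)) (secval Op) (secval_monoid Op).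

Lemma secval_eq (s t : rs_sec O) :
  (forall p (Op : O (pi p)), secval Op s = secval Op t) -> s = t.
Proof. by move=> h; apply: val_inj; apply: sec_eq => p Op; exact: h. Qed.

(** The two pullbacks of [s] to [Spec A[D]] coincide; this is their equality in the local ring at
    [z]. *)
Lemma secval_invariant (s : rs_sec O) z (Oa : O (pi (comap psi z)))
    (Op : O (pi (comap (@ga_const A D) z))) :
  loc_map (@comap_compl _ _ psi z) (secval Oa s) =
  loc_map (@comap_compl _ _ (@ga_const A D) z) (secval Op s).
Proof.
have /asboolP e := valP s.
pose W := opens_preim (mor_cont (proj_mor D A))
  (opens_preim (coeq_pi_cont (f:=act_mor G) (g:=proj_mor D A)) O).
have := congr1 (fun t : spec_sec W => @sec_fun _ W t z Op) e.
rewrite /= => <-; congr (loc_map _ (sec_fun _ _)); exact: Prop_irrelevance.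
Qed.

(** The coaction multiplies [a] and [g] by the same monomial of degree [d], a unit of [A[D]], so the
    fraction [a / g] is invariant and descends. *)
Lemma homogeneous_section (t : forall p, O (pi p) -> loc (prime_compl p)) :
  (forall p, O (pi p) -> exists d a g, [/\ G d a, G d g, ~ p g &
     forall r (Or : O (pi r)), ~ r g ->
       loc_inj (prime_compl r) g * t r Or = loc_inj (prime_compl r) a]) ->
  exists s : rs_sec O, forall p (Op : O (pi p)), secval Op s = t p Op.
Proof.
move=> ht.
pose U := opens_preim (coeq_pi_cont (f:=act_mor G) (g:=proj_mor D A)) O.
have tloc : @locally_fraction A U t.
  move=> p Up; have [d [a [g [Ga Gg pg h]]]] := ht p Up.
  have oV : open [set r : primeIdeal A | U r /\ ~ r g].
    apply: (@openI _ U [set r : primeIdeal A | ~ r g]); first exact: opensP.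
    exists [set g]; apply/seteqP; split=> r /=; first by move=> rg /(_ g erefl).
    by apply: contra_not => rg _ ->.
  exists (Opens oV), (fun r hr => proj1 hr), a, g; split=> // r [Ur rg].
  by exists rg; apply/loc_fracE; exact: h.
pose s0 : spec_sec U := SpecSec tloc.
have s0inv : @coeq_invariant _ _ (act_mor G) (proj_mor D A) O s0.
  apply/asboolP; apply: sec_eq => z Op /=.
  set Oa := coeq_sub _; move: Oa => Oa.
  have [d [a [g [Ga Gg zg h]]]] := ht _ Oa.
  have zg' : ~ comap (@ga_const A D) z g.
    by move: zg; rewrite (coeq_rel_homogeneous (G := G)
        (q := comap (@ga_const A D) z)) //;
      [exists d|apply: rst_step; exists z].
  apply: (@loc_inj_cancel _ _ (@ga_const A D g)) => //.
  have := h _ Op zg' => /(congr1 (loc_map (@comap_compl _ _ (@ga_const A D) z))).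
  rewrite rmorphM /= !loc_map_inj => ->.
  (* This monomial has the inverse [ga_mono 1 (- d)], so it lies in no prime and may be
     cancelled. *)
  apply: (@loc_inj_cancel _ _ (ga_mono 1 d)).
    case: (Defs.primeP z) => [[_ _ zM] z1 _] zd; apply: z1.
    have -> : 1 = ga_mono 1 (- d) * ga_mono 1 d :> groupAlg A D.
      by rewrite ga_monoM mulr1 addNr.
    exact: zM.
  have := h _ Oa zg => /(congr1 (loc_map (@comap_compl _ _ psi z))).
  rewrite rmorphM /= !loc_map_inj.
  rewrite [X in loc_inj _ X * _ = _](coaction_homogeneous Gg).
  rewrite [X in _ = loc_inj _ X -> _](coaction_homogeneous Ga).
  by rewrite mulrA -!rmorphM !ga_monoM !mul1r !addr0 => ->.
by exists (exist (fun s => @coeq_invariant _ _ (act_mor G) (proj_mor D A) O s)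
  s0 s0inv).
Qed.

(** Start from a numerator [y] given by [section_fraction]. Invariance makes [psi y] and [y] times
    the monomial of degree [d *+ N] agree at all primes of [A[D]] missing [h], so [y] can be
    replaced by its component of that degree. *)
Lemma section_homogeneous (hA : normal_ring A) (s : rs_sec O) h d :
  G d h -> (forall r, ~ r h -> O (pi r)) ->
  exists N y, G (d *+ N) y /\ forall r (Or : O (pi r)), ~ r h ->
    loc_inj (prime_compl r) (h ^+ N) * secval Or s = loc_inj (prime_compl r) y.
Proof.
move=> Gh hO; have [N [y hy]] := section_fraction hA (coeq_incl s : spec_sec _) hO.
exists N, (psi y (d *+ N)); split; first exact: coaction_piece.
have Gn := pieceX N Gh.
have [|m hm] := @locally_zero_power _ (@ga_const A D h)
    (psi y - ga_mono 1 (d *+ N) * ga_const D y).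
  move=> z zh; have Op := hO (comap (@ga_const A D) z) zh.
  have zh' : ~ comap psi z h.
    by rewrite (coeq_rel_homogeneous (G := G)
        (q := comap (@ga_const A D) z)) //;
      [exists d|apply: rst_step; exists z].
  have Oa := hO (comap psi z) zh'.
  have := congr1 (loc_map (@comap_compl _ _ psi z)) (hy _ Oa zh').
  have := congr1 (loc_map (@comap_compl _ _ (@ga_const A D) z)) (hy _ Op zh).
  rewrite !rmorphM /= !loc_map_inj -/(secval Oa s) -/(secval Op s).
  rewrite (secval_invariant s Oa Op).
  move=> E; rewrite [X in loc_inj _ X * _ = _](coaction_homogeneous Gn) => E'.
  suff E2 : loc_inj (prime_compl z) (psi y) =
      loc_inj (prime_compl z) (ga_mono 1 (d *+ N) * ga_const D y).
    by rewrite rmorphB /= E2 subrr.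
  by rewrite -E' rmorphM /= -E mulrA -rmorphM ga_monoM mul1r addr0.
(* The coefficient in degree [d *+ N] shows that [h ^+ m] kills the difference between [y] and its
   component. *)
move=> r Or rh; rewrite hy //; apply/loc_inj_eq; exists (h ^+ m); first by move/primeX.
have := congr1 (fun g : groupAlg A D => g (d *+ N)) hm.
rewrite -rmorphXn ga_mono_mulE subr0 => /=.
rewrite [X in _ * X](_ : _ = psi y (d *+ N) - y); last first.
  rewrite -[LHS]/(psi y (d *+ N) - (ga_mono 1 (d *+ N) * ga_const D y) (d *+ N)).
  by rewrite ga_mono_mulE subrr /= eqxx mul1r.
rewrite [X in _ = X -> _](_ : _ = 0); last by case: ifP.
by move=> /eqP; rewrite mulrBr subr_eq0 => /eqP ->.
Qed.

End Values.
End Quotient.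

(** * Stalks of the quotient *)

Section StalkLift.
Variables (X : ringedSpace) (x : rs_top X) (N : comPzRingType).
Variable e : forall U : opens (rs_top X), U x -> {rmorphism rs_sec U -> N}.
Hypothesis e_res : forall (U V : opens (rs_top X)) (Ux : U x) (Vx : V x)
  (h : opens_sub V U) s,
  e Vx (rs_res h s) = e Ux s.

(** The map induced on the colimit by the compatible family [e], evaluated on a chosen
    representative of the germ. *)
Definition stalk_lift (y : stalk x) : N :=
  let r : germ_rep x := repr (y : {eq_quot germ_equiv x}) in
  e (proj2_sig (projT1 r)) (projT2 r).

Lemma stalk_lift_germ (U : opens (rs_top X)) (Ux : U x) s :
  stalk_lift (germ Ux s) = e Ux s.
Proof.
have /germ_eq [W [h [k [Wx E]]]] := germ_rep_eq (germ Ux s).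
by rewrite /stalk_lift -(e_res _ Wx h) E e_res.
Qed.

Lemma stalk_lift_zmod : zmod_morphism stalk_lift.
Proof.
move=> y z; have [U [Ux [s [t [_ [-> -> _]]]]]] := germ_common y z z.
have -> : germ Ux s - germ Ux t = germ Ux (s - t).
  by rewrite -germD -germN.
by rewrite !stalk_lift_germ rmorphB.
Qed.

Lemma stalk_lift_monoid : monoid_morphism stalk_lift.
Proof.
split=> [|y z]; first by rewrite stalk_lift_germ rmorph1.
have [U [Ux [s [t [_ [-> -> _]]]]]] := germ_common y z z.
by rewrite [X in stalk_lift X]germM !stalk_lift_germ rmorphM.
Qed.

HB.instance Definition _ :=
  GRing.isZmodMorphism.Build (stalk x) N stalk_lift stalk_lift_zmod.
HB.instance Definition _ :=
  GRing.isMonoidMorphism.Build (stalk x) N stalk_lift stalk_lift_monoid.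

Definition stalk_mor : {rmorphism stalk x -> N} := stalk_lift.

Lemma stalk_mor_germ (U : opens (rs_top X)) (Ux : U x) s :
  stalk_mor (germ Ux s) = e Ux s.
Proof. exact: stalk_lift_germ. Qed.

End StalkLift.

(** * Stalks as normal subrings of the local rings of [A] *)

Section NormalStalk.
Variables (D : zmodType) (A : comPzRingType) (G : grading D A).
Implicit Types (p q r : primeIdeal A).
Local Notation psi := (coaction G).
Local Notation Q := (quotient_space G).
Local Notation pi := (quotient_pi G).

Lemma homogeneousM a b : homogeneous G a -> homogeneous G b -> homogeneous G (a * b).
Proof. by move=> [d Ga] [e Gb]; exists (d + e); exact: pieceM. Qed.

Lemma D_plusP h r : homogeneous G h -> D_plus (G:=G) h (pi r) <-> ~ r h.
Proof.
move=> hh; split=> [[q qh /quotient_pi_eq E]|rh]; last by exists r.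
by move/(E h hh).
Qed.

Lemma secval_res (O V : opens (rs_top Q)) (h : opens_sub V O) p
    (Op : O (pi p)) (Vp : V (pi p)) (s : rs_sec O) :
  secval Vp (rs_res h s) = secval Op s.
Proof. by rewrite (Prop_irrelevance Op (coeq_pre_sub h Vp)). Qed.

Variables (U0 : opens (rs_top Q)) (hA : normal_ring A).
Variables (x : rs_top (open_subspace U0)) (p : primeIdeal A).
Hypothesis px : pi p = set_val x.

Let lift_mem (U : opens (rs_top (open_subspace U0))) : U x -> opens_lift U (pi p).
Proof. by move=> Ux; exists x. Qed.

Let ev (U : opens (rs_top (open_subspace U0))) (Ux : U x) :
  {rmorphism rs_sec U -> loc (prime_compl p)} :=
  secval (lift_mem Ux) : {rmorphism rs_sec (opens_lift U) -> loc (prime_compl p)}.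

Let ev_res (U V : opens (rs_top (open_subspace U0))) (Ux : U x) (Vx : V x)
    (h : opens_sub V U) s :
  ev Vx (rs_res h s) = ev Ux s.
Proof. exact: secval_res. Qed.

(** Evaluation at a prime [p] above [x], through which the stalk is viewed as a subring of [A_p]. *)
Definition stalk_val : {rmorphism stalk x -> loc (prime_compl p)} := stalk_mor ev_res.

Let small_open h (hh : homogeneous G h) : opens (rs_top (open_subspace U0)).
Proof.
apply: (@Opens _ (set_val @^-1` D_plus (G:=G) h)); exists (D_plus (G:=G) h) => //.
exact: D_plus_open.
Defined.

Let small_openE h (hh : homogeneous G h) r :
  opens_lift (small_open hh) (pi r) -> ~ r h.
Proof. by move=> [y yh e]; apply/(D_plusP r hh); rewrite -e. Qed.

Let small_open_sub (U : opens (rs_top (open_subspace U0))) h k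
    (hh : homogeneous G (h * k)) :
  (forall r, ~ r h -> opens_lift U (pi r)) -> opens_sub (small_open hh) U.
Proof.
move=> hU y [r /= rhk e]; have [y' Uy' e'] : opens_lift U (pi r).
  by apply: hU => rh; apply: rhk; apply/primeM; left.
by rewrite (_ : y = y') //; apply: val_inj; rewrite /= -[RHS]/(set_val y') e' e.
Qed.

Let small_openx h (hh : homogeneous G h) : ~ p h -> small_open hh x.
Proof. by move=> ph; rewrite /= /preimage /= -px; exact/D_plusP. Qed.

(** A section with value zero in [A_p] has, near [x], a homogeneous numerator killed by some [u]
    outside [p]. A component [v] of [u] outside [p] kills it as well, so the section vanishes on a
    homogeneous neighbourhood. *)
Lemma stalk_val_inj : injective stalk_val.
Proof.
move=> y z; have [U [Ux [s [t [_ [-> -> _]]]]]] := germ_common y z z.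
rewrite /stalk_val !stalk_mor_germ => E.
pose w : rs_sec (opens_lift U) := s - t.
have w0 : secval (lift_mem Ux) w = 0.
  by rewrite rmorphB; apply/eqP; rewrite subr_eq0; exact/eqP.
have [h [[d Gh] ph hU]] := homogeneous_nbhd (lift_mem Ux).
have [N [c [Gc hc]]] := section_homogeneous hA w Gh hU.
have := hc p (lift_mem Ux) ph; rewrite w0 mulr0 => /esym /loc_inj_eq0 [u pu uc].
have [e pe] := prime_component G pu.
set v := psi u e in pe; have Gv : G e v by exact: coaction_piece.
have vc : v * c = 0.
  have := coactionM u (d *+ N + e) Gc.
  rewrite addrAC subrr add0r -/v [c * v]mulrC => <-.
  by rewrite mulrC uc coaction0 /=; case: ifP.
have hv : homogeneous G (h * v) by apply: homogeneousM; [exists d|exists e].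
have hW := small_open_sub (hh := hv) hU.
apply/germ_eq; exists (small_open hv), hW, hW.
split; first by apply: small_openx => /primeM [].
apply/eqP; rewrite -subr_eq0 -rmorphB; apply/eqP; apply: secval_eq => r Or.
rewrite rmorph0; have /primeM rhv := small_openE Or.
have rh : ~ r h by move=> rh; apply: rhv; left.
have Ur := hU r rh.
rewrite [LHS](secval_res _ Ur).
apply: (@loc_inj_cancel _ (prime_compl r) (v * h ^+ N)).
  by move=> /primeM [rv|/primeX //]; apply: rhv; right.
by rewrite mulr0 rmorphM -mulrA hc // -rmorphM vc rmorph0.
Qed.

(** By [normal_domain_sub] it suffices that a quotient [f] in [A_p] of two elements of the stalk
    comes from the stalk. Comparing homogeneous components rewrites [f] as a fraction of elements of
    equal degree. *)
Lemma stalk_normal : normal_domain (stalk x).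
Proof.
apply: (normal_domain_sub stalk_val_inj (hA p)) => y z f z0 E.
have [U [Ux [s [t [_ [yE zE _]]]]]] := germ_common y z z.
have [h [[d Gh] ph hU]] := homogeneous_nbhd (lift_mem Ux).
have [N [c [Gc hc]]] := section_homogeneous hA (s : rs_sec (opens_lift U)) Gh hU.
have [M [b [Gb hb]]] := section_homogeneous hA (t : rs_sec (opens_lift U)) Gh hU.
have := hc p (lift_mem Ux) ph; have := hb p (lift_mem Ux) ph.
have -> : secval (lift_mem Ux) s = stalk_val y.
  by rewrite yE /stalk_val stalk_mor_germ.
have -> : secval (lift_mem Ux) t = stalk_val z.
  by rewrite zE /stalk_val stalk_mor_germ.
(* The cross factors bring the two numerators to the common degree [d *+ (M + N)]. *)
move=> {}hb {}hc; pose c1 := h ^+ M * c; pose b1 := h ^+ N * b.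
have Gc1 : G (d *+ (M + N)) c1.
  by rewrite mulrnDr; apply: pieceM => //; exact: pieceX.
have Gb1 : G (d *+ (M + N)) b1.
  by rewrite addnC mulrnDr; apply: pieceM => //; exact: pieceX.
have E1 : loc_inj (prime_compl p) c1 = loc_inj (prime_compl p) b1 * f.
  by rewrite !rmorphM /= -hc -hb E; ring.
have [a [g0 [pg0 fE]]] := loc_fracP f.
have : loc_inj (prime_compl p) (c1 * g0) = loc_inj (prime_compl p) (b1 * a).
  by rewrite rmorphM [RHS]rmorphM /= E1 -mulrA [f * _]mulrC fE loc_den_mul.
move=> /loc_inj_eq [u pu uE].
have pug : ~ p (u * g0) by move=> /primeM [].
have [e pe] := prime_component G pug.
(* Since [c1] and [b1] have the same degree, taking one component of the relation between them
   leaves [g] and [a'] of the same degree [e]. *)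
set g := psi (u * g0) e in pe; pose a' := psi (u * a) e.
have gE : c1 * g = b1 * a'.
  have := coactionM (u * g0) (d *+ (M + N) + e) Gc1.
  rewrite [_ + e]addrC addrK -/g => <-; rewrite mulrCA uE mulrCA.
  by rewrite (coactionM _ _ Gb1) addrK.
have Gg : G e g by exact: coaction_piece.
have Ga : G e a' by exact: coaction_piece.
have hg : homogeneous G (h * g) by apply: homogeneousM; [exists d|exists e].
have rg r : opens_lift (small_open hg) (pi r) -> prime_compl r g.
  by move=> /small_openE rhg rg; apply: rhg; apply/primeM; right.
have [|k hk] := @homogeneous_section _ _ G (opens_lift (small_open hg))
    (fun r Or => loc_frac a' (rg r Or)).
  move=> r Or; exists e, a', g; split=> //; first exact: rg.
  by move=> q Oq _; exact: loc_den_mul.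
have Wx : small_open hg x by apply: small_openx => /primeM [].
exists (germ Wx (k : rs_sec (small_open hg))); apply: stalk_val_inj.
rewrite E rmorphM; congr (_ * _); rewrite /stalk_val stalk_mor_germ.
apply: etrans (esym (hk p (lift_mem Wx))); apply/loc_fracE.
have [_ ND _] := hA p.
have : loc_inj (prime_compl p) b1 *
    (loc_inj (prime_compl p) g * f - loc_inj (prime_compl p) a') = 0.
  by rewrite mulrBr mulrCA -E1 -!rmorphM mulrC gE subrr.
(* In the domain [A_p] either [g * f = a'], as wanted, or [b1] is zero, and the latter would make
   [z] zero. *)
move=> /ND [b0|/eqP]; last by rewrite subr_eq0 => /eqP.
case: z0; apply: stalk_val_inj; rewrite rmorph0.
apply: (@loc_inj_cancel _ (prime_compl p) (h ^+ N * h ^+ M)).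
  by move=> /primeM [|] /primeX.
by rewrite mulr0 rmorphM -mulrA hb -[RHS]b0 /b1 rmorphM.
Qed.

End NormalStalk.

(** * The ring [A_(f)] *)

Section DegreeZero.
Variables (D : zmodType) (A : comPzRingType) (G : grading D A).
Variables (f : A) (e : D) (Gf : G e f).
Implicit Types (p q r : primeIdeal A).
Local Notation psi := (coaction G).
Local Notation pi := (quotient_pi G).

Definition pow_mem n : powers f (f ^+ n) := ex_intro _ n erefl.

(** The ring [A_(f)] as a subring of [A_f]. The proof in the index fixes a degree of [f], since zero
    has every degree. *)
Definition deg0_pred (_ : G e f) : pred (loc (powers f)) := fun x =>
  `[< exists n a, G (e *+ n) a /\ x = loc_frac a (pow_mem n) >].

Definition deg0 := {x | deg0_pred Gf x}.

Lemma deg0_subring : subring_closed (deg0_pred Gf).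
Proof.
split.
- apply/asboolP; exists 0%N, 1; split; first exact: piece1.
  by apply: loc_eqW; rewrite expr0.
- move=> _ _ /asboolP [n [a [Ga ->]]] /asboolP [m [b [Gb ->]]].
  apply/asboolP; exists (n + m)%N, (a * f ^+ m - b * f ^+ n); split.
    apply: pieceB; first by rewrite mulrnDr; apply: pieceM => //; exact: pieceX.
    by rewrite addnC mulrnDr; apply: pieceM => //; exact: pieceX.
  by rewrite loc_fracB; apply: loc_eqW; rewrite exprD.
- move=> _ _ /asboolP [n [a [Ga ->]]] /asboolP [m [b [Gb ->]]].
  apply/asboolP; exists (n + m)%N, (a * b); split.
    by rewrite mulrnDr; exact: pieceM.
  by rewrite loc_fracM; apply: loc_eqW; rewrite exprD.
Qed.

HB.instance Definition _ := SubType.on deg0.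
HB.instance Definition _ := Choice.on deg0.
HB.instance Definition _ :=
  GRing.SubChoice_isSubComPzRing.Build _ _ deg0 deg0_subring.

Lemma deg0_frac_subproof n a : G (e *+ n) a -> deg0_pred Gf (loc_frac a (pow_mem n)).
Proof. by move=> Ga; apply/asboolP; exists n, a. Qed.

Definition deg0_frac n a (Ga : G (e *+ n) a) : deg0 :=
  exist (fun x => deg0_pred Gf x) _ (deg0_frac_subproof Ga).

Lemma deg0_fracP (x : deg0) : exists n a (Ga : G (e *+ n) a), x = deg0_frac Ga.
Proof.
case: x => x hx; have /asboolP [n [a [Ga xE]]] := hx.
by exists n, a, Ga; apply: val_inj.
Qed.

Lemma deg0_fracE n a (Ga : G (e *+ n) a) m b (Gb : G (e *+ m) b) :
  (exists l, f ^+ l * (a * f ^+ m) = f ^+ l * (b * f ^+ n)) <->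
  deg0_frac Ga = deg0_frac Gb.
Proof.
split=> [[l h]|/(congr1 val) /loc_eq [_ [l ->] h]]; last by exists l.
by apply: val_inj; apply/loc_eq; exists (f ^+ l) => //; exists l.
Qed.

Lemma deg0_frac0 n (G0 : G (e *+ n) 0) : deg0_frac G0 = 0.
Proof. by apply: val_inj; apply: loc_eqW; rewrite !mul0r. Qed.

Lemma deg0_frac1 n (Gn : G (e *+ n) (f ^+ n)) : deg0_frac Gn = 1.
Proof. by apply: val_inj; apply: loc_eqW; rewrite mul1r mulr1. Qed.

Lemma deg0_fracD n a (Ga : G (e *+ n) a) b (Gb : G (e *+ n) b)
  (Gab : G (e *+ n) (a + b)) : deg0_frac Gab = deg0_frac Ga + deg0_frac Gb.
Proof.
apply: val_inj; rewrite /= -[RHS]/(loc_add _ _) loc_addE.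
by apply: loc_eqW; ring.
Qed.

Lemma deg0_fracM n a (Ga : G (e *+ n) a) m b (Gb : G (e *+ m) b)
    l c (Gc : G (e *+ l) c) : c * f ^+ (n + m) = a * b * f ^+ l ->
  deg0_frac Ga * deg0_frac Gb = deg0_frac Gc.
Proof.
move=> h; apply: val_inj; rewrite /= loc_fracM.
by apply: loc_eqW; rewrite -h exprD.
Qed.

(** * Contraction of primes from [D(f)] to [A_(f)] *)

Section Contraction.
Variables (p : primeIdeal A) (pf : ~ p f).

Lemma powers_compl s : powers f s -> prime_compl p s.
Proof. by move=> [n ->] /primeX. Qed.

Definition theta : {rmorphism deg0 -> loc (prime_compl p)} :=
  loc_map (phi := idfun) powers_compl \o val.

Lemma theta_frac n a (Ga : G (e *+ n) a) :
  loc_inj (prime_compl p) (f ^+ n) * theta (deg0_frac Ga) =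
  loc_inj (prime_compl p) a.
Proof. by rewrite /theta /= loc_mapE loc_den_mul. Qed.

(** The preimage in [A_(f)] of the extension of [p] to [A_f], stated through one representative;
    [contraction_frac] shows that any other one may be used. *)
Definition contraction_set (x : deg0) :=
  exists n a (Ga : G (e *+ n) a), p a /\ x = deg0_frac Ga.

Lemma contraction_frac n a (Ga : G (e *+ n) a) :
  contraction_set (deg0_frac Ga) <-> p a.
Proof.
split=> [[m [b [Gb [pb /deg0_fracE [l h]]]]]|pa]; last by exists n, a, Ga.
have : p (f ^+ l * (a * f ^+ m)).
  by rewrite h; apply/primeM; right; apply/primeM; left.
by move=> /primeM [/primeX //|/primeM [//|/primeX]].
Qed.

Lemma contraction_prime : is_prime (contraction_set : set deg0).
Proof.
split; first split.
- exists 0%N, 0, (piece0 G _); rewrite deg0_frac0; split=> //.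
  by case: (prime_ideal p).
- move=> x y [n [a [Ga [pa ->]]]] [m [b [Gb [pb ->]]]].
  have Ga' : G (e *+ (n + m)) (a * f ^+ m).
    by rewrite mulrnDr; apply: pieceM => //; exact: pieceX.
  have Gb' : G (e *+ (n + m)) (b * f ^+ n).
    by rewrite addnC mulrnDr; apply: pieceM => //; exact: pieceX.
  have Gc : G (e *+ (n + m)) (a * f ^+ m + b * f ^+ n).
    exact: pieceD.
  exists (n + m)%N, (a * f ^+ m + b * f ^+ n), Gc; split.
    by case: (prime_ideal p) => _ pD _; apply: pD; apply/primeM; left.
  rewrite (deg0_fracD Ga' Gb'); congr (_ + _); apply/deg0_fracE; exists 0%N;
    by rewrite exprD; ring.
- move=> x y [m [b [Gb [pb ->]]]]; have [n [a [Ga ->]]] := deg0_fracP x.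
  have Gab : G (e *+ (n + m)) (a * b) by rewrite mulrnDr; exact: pieceM.
  by rewrite (deg0_fracM Ga Gb Gab) //; apply/contraction_frac/primeM; right.
- have G1 : G (e *+ 0) (f ^+ 0) by exact: piece1.
  rewrite -(deg0_frac1 G1) => /contraction_frac; rewrite expr0.
  by case: (Defs.primeP p).
- move=> x y; have [n [a [Ga ->]]] := deg0_fracP x.
  have [m [b [Gb ->]]] := deg0_fracP y.
  have Gab : G (e *+ (n + m)) (a * b) by rewrite mulrnDr; exact: pieceM.
  rewrite (deg0_fracM Ga Gb Gab) // => /contraction_frac /primeM [] h;
    by [left; apply/contraction_frac|right; apply/contraction_frac].
Qed.

Definition contraction : primeIdeal deg0 := PrimeIdeal contraction_prime.

Lemma theta_unit s : prime_compl contraction s -> exists t, theta s * t = 1.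
Proof.
have [n [a [Ga ->]]] := deg0_fracP s.
move=> /(@contra_not _ _ (contraction_frac Ga).2) pa.
have [r ra] := loc_inj_unit (S := prime_compl p) pa.
exists (loc_inj (prime_compl p) (f ^+ n) * r).
by rewrite mulrA [theta _ * _]mulrC theta_frac.
Qed.

Definition local_lift :
    {rmorphism loc (prime_compl contraction) -> loc (prime_compl p)} :=
  loc_lift theta_unit.

Lemma local_lift_frac x s (hs : prime_compl contraction s) :
  theta s * local_lift (loc_frac x hs) = theta x.
Proof. exact: loc_lift_frac. Qed.

End Contraction.

(** Any prime containing the ideal [I] below and avoiding the numerators of fractions outside [q]
    contracts to [q]. *)
Lemma contraction_surj (q : primeIdeal deg0) :
  exists p (pf : ~ p f), contraction pf = q.
Proof.
have [[q0 qD qM] q1 qP] := Defs.primeP q.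
pose F a n := deg0_frac (coaction_piece G a (e *+ n)).
have FE a n (Ga : G (e *+ n) a) : F a n = deg0_frac Ga.
  apply/deg0_fracE; exists 0%N; congr (_ * (_ * _)).
  by rewrite (coaction_homogeneous Ga) /= eqxx.
(* The largest ideal of [A] whose elements have all their components of degrees [e *+ n] giving
   fractions in [q]; quantifying over [b] makes it an ideal. *)
pose I : set A := [set a | forall b n, q (F (a * b) n)].
have hI : is_ideal I.
  split.
  - by move=> b n; rewrite mul0r (FE 0 n (piece0 G _)) deg0_frac0.
  - move=> a a' ha ha' b n; have h := qD _ _ (ha b n) (ha' b n).
    have Gs : G (e *+ n) (psi (a * b) (e *+ n) + psi (a' * b) (e *+ n)).
      by apply: pieceD; exact: coaction_piece.
    move: h; rewrite -(deg0_fracD _ _ Gs).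
    rewrite [X in q X -> _](_ : _ = F ((a + a') * b) n) //.
    apply/deg0_fracE; exists 0%N; congr (_ * (_ * _)).
    rewrite mulrDl.
    by have -> : psi (a * b + a' * b) = psi (a * b) + psi (a' * b) by exact: rmorphD.
  - by move=> c a ha b n; rewrite [c * a]mulrC -mulrA; exact: ha.
pose M : set A := [set s | exists n (Gs : G (e *+ n) s), ~ q (deg0_frac Gs)].
have M1 : M 1.
  have G1 : G (e *+ 0) (f ^+ 0) by exact: piece1.
  by exists 0%N, G1; rewrite (deg0_frac1 G1).
have MM a b : M a -> M b -> M (a * b).
  move=> [n [Ga qa]] [m [Gb qb]].
  have Gab : G (e *+ (n + m)) (a * b) by rewrite mulrnDr; exact: pieceM.
  exists (n + m)%N, Gab; rewrite -(deg0_fracM Ga Gb) //.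
  by move=> /qP [].
have [a Ia [n [Ga qa]]|p [pI pM]] := prime_avoiding (M := MulSet M1 MM) hI.
  by apply: qa; rewrite -FE -[a]mulr1; exact: Ia.
have pf : ~ p f.
  have Gf1 : G (e *+ 1) (f ^+ 1) by [].
  by move=> /pM; apply; exists 1%N, Gf1; rewrite (deg0_frac1 Gf1).
exists p, pf; apply: prime_ext => x; have [n [a [Ga ->]]] := deg0_fracP x.
split.
  move=> /(contraction_frac pf Ga) pa; apply: contrapT => qa.
  by apply: (pM _ pa); exists n, Ga.
(* A numerator [a] of an element of [q] lies in [I]: the component of [a * b] is [a] times a
   component of [b], and a factor [f ^+ n] corrects the degree. *)
move=> qa; apply/(contraction_frac pf Ga); apply: pI => b m.
have Gc : G (e *+ m) (psi b (e *+ m - e *+ n) * f ^+ n).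
  rewrite -[X in G X _](subrK (e *+ n)); apply: pieceM; last exact: pieceX.
  exact: coaction_piece.
rewrite /F -(deg0_fracM Gc Ga); first exact: qM.
by rewrite (coactionM _ _ Ga) exprD; ring.
Qed.

Lemma contraction_pi p q (pf : ~ p f) (qf : ~ q f) :
  pi p = pi q -> contraction pf = contraction qf.
Proof.
move=> /quotient_pi_eq h; apply: prime_ext => x.
have [n [a [Ga ->]]] := deg0_fracP x.
have ha : homogeneous G a by exists (e *+ n).
by split=> [/(contraction_frac pf Ga)|/(contraction_frac qf Ga)] hp;
  [apply/(contraction_frac qf Ga)|apply/(contraction_frac pf Ga)]; apply/(h a ha).
Qed.

(** * Consequences of relevance for [A_(f)] *)

Hypothesis frel : relevant G f.

(** Take [N] and [k] from [relevant_degree] and [b = h ^+ N * k]. The factor [k] divides a power of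
    [f], so it has no zeros on [D(f)], and [N] is positive. *)
Lemma degree_zero_multiple d h : G d h -> exists m b,
  [/\ G (e *+ m) b, (exists c, b = h * c) & forall p, ~ p f -> (p b <-> p h)].
Proof.
move=> Gh; have [N [m [k [c [j [N0 Gk E]]]]]] := relevant_degree frel Gf d.
exists m, (h ^+ N * k); split.
- by rewrite -[X in G X _](subrK (d *+ N)) addrC; apply: pieceM => //; exact: pieceX.
- by exists (h ^+ N.-1 * k); rewrite mulrA -exprS prednK.
- move=> p pf; have pk : ~ p k.
    by move=> pk; apply: pf; apply: (@primeX _ p f j); rewrite -E; apply/primeM; right.
  split=> [/primeM [/primeX //|/pk //]|ph]; apply/primeM; left.
  by rewrite -(prednK N0) exprS; apply/primeM; left.
Qed.

Lemma contraction_inj p q (pf : ~ p f) (qf : ~ q f) :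
  contraction pf = contraction qf -> pi p = pi q.
Proof.
move=> E; apply/quotient_pi_eq => a [d Ga].
have [m [b [Gb _ hb]]] := degree_zero_multiple Ga.
rewrite -(hb p pf) -(hb q qf) -(contraction_frac pf Gb) -(contraction_frac qf Gb).
rewrite -[contraction_set p _]/(contraction pf (deg0_frac Gb)) E.
by [].
Qed.

(** If [X / S] maps to zero, a homogeneous [v] outside [p] kills the numerator of [X]. Its multiple
    [b] from [degree_zero_multiple] yields an element of [A_(f)] outside the contracted prime that
    kills [X]. *)
Lemma local_lift_inj p (pf : ~ p f) : injective (local_lift pf).
Proof.
move=> y z /eqP; rewrite -subr_eq0 -rmorphB => /eqP E; apply/eqP; rewrite -subr_eq0.
apply/eqP; move: (y - z) E => {y z} x.
have [X [S [hS ->]]] := loc_fracP x => E.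
have := local_lift_frac X hS; rewrite E mulr0.
have [n [a [Ga XE]]] := deg0_fracP X; rewrite XE in E * => /esym t0.
have := theta_frac pf Ga; rewrite t0 mulr0 => /esym /loc_inj_eq0 [u pu ua].
have [d pd] := prime_component G pu.
set v := psi u d in pd; have Gv : G d v by exact: coaction_piece.
have va : v * a = 0.
  have := coactionM u (e *+ n + d) Ga.
  rewrite addrAC subrr add0r -/v [a * v]mulrC => <-.
  by rewrite mulrC ua coaction0 /=; case: ifP.
have [m [b [Gb [c bE] hb]]] := degree_zero_multiple Gv.
apply/loc_eq; exists (deg0_frac Gb).
  by move=> /(contraction_frac pf Gb) /(hb p pf).
rewrite mulr1 mul0r mulr0.
have G0 : G (e *+ (m + n)) 0 by exact: piece0.
rewrite (deg0_fracM Gb Ga G0) ?deg0_frac0 //.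
by rewrite mul0r bE (mulrAC v) va !mul0r.
Qed.

End DegreeZero.

(** * The chart [Spec A_(f)] *)

Lemma basic_openP (A : comPzRingType) (U : set (primeIdeal A)) :
  (forall p, U p -> exists x, ~ p x /\ forall q : primeIdeal A, ~ q x -> U q) ->
  open U.
Proof.
move=> h; exists [set x | forall q : primeIdeal A, ~ q x -> U q].
apply/seteqP; split=> p /=; first by move=> /h [x [px xU]] /(_ x xU).
by move=> /existsNP [x /not_implyP [xU px]]; exact: xU.
Qed.

Section AffineChart.
Variables (D : zmodType) (A : comPzRingType) (G : grading D A).
Hypothesis hA : normal_ring A.
Local Notation psi := (coaction G).
Local Notation Q := (quotient_space G).
Local Notation pi := (quotient_pi G).
Implicit Types (p r : primeIdeal A).
Variables (f : A) (e : D) (Gf : G e f) (frel : relevant G f).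
Variables (O0 : opens (rs_top Q)) (U : opens (rs_top (open_subspace O0))).
Hypothesis UE : forall x, U x <-> D_plus (G:=G) f (set_val x).
Hypothesis fO0 : D_plus (G:=G) f `<=` O0.

Let Y := open_subspace U.
Let C := deg0 Gf.
Let toQ (y : rs_top Y) : rs_top Q := set_val (set_val y).

Lemma toQ_inj : injective toQ.
Proof. by move=> y z /val_inj /val_inj. Qed.

Lemma toQ_rep (y : rs_top Y) : exists p, pi p = toQ y /\ ~ p f.
Proof.
have /UE [p pf yp] : U (set_val y) by case: y => y hy; exact: set_mem hy.
by exists p; split=> //; exact: yp.
Qed.

Lemma toQ_lift p : ~ p f -> exists y, toQ y = pi p.
Proof.
move=> pf; have Dp : D_plus (G:=G) f (pi p) by exists p.
pose x : rs_top (open_subspace O0) := SigSub (mem_set (fO0 Dp)).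
have Ux : U x by apply/UE.
by exists (SigSub (mem_set Ux)).
Qed.

(** By [chartE] the value does not depend on the prime chosen above [y]. *)
Definition chart (y : rs_top Y) : primeIdeal C :=
  contraction Gf (projT2 (cid (toQ_rep y))).2.

Lemma chartE y p (pf : ~ p f) : toQ y = pi p -> chart y = contraction Gf pf.
Proof.
move=> yp; rewrite /chart; case: (cid _) => q [/= hq qf].
by apply: contraction_pi; rewrite hq.
Qed.

Lemma chart_surj (q : primeIdeal C) : exists p (pf : ~ p f) y,
  [/\ contraction Gf pf = q, toQ y = pi p & chart y = q].
Proof.
have [p [pf pq]] := contraction_surj q; have [y yp] := toQ_lift pf.
by exists p, pf, y; split=> //; rewrite (chartE pf yp).
Qed.

Lemma chart_bij : bijective chart.
Proof.
apply: inj_surj_bijective => [y z|q]; last first.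
  by have [_ [_ [y [_ _ yq]]]] := chart_surj q; exists y.
have [p [py pf]] := toQ_rep y; have [q [qz qf]] := toQ_rep z.
rewrite (chartE pf (esym py)) (chartE qf (esym qz)) => h.
by apply: toQ_inj; rewrite -py -qz; exact: (contraction_inj frel h).
Qed.

Definition lift2 (W : opens (rs_top Y)) : opens (rs_top Q) := opens_lift (opens_lift W).

Lemma lift2P (W : opens (rs_top Y)) p :
  lift2 W (pi p) -> exists y, W y /\ toQ y = pi p.
Proof. by move=> [_ [y Wy <-] h]; exists y. Qed.

Lemma lift2I (W : opens (rs_top Y)) p y : W y -> toQ y = pi p -> lift2 W (pi p).
Proof. by move=> Wy <-; exists (set_val y) => //; exists y. Qed.

Lemma chart_continuous : continuous chart.
Proof.
apply/continuousP => V oV.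
pose W : set (rs_top Q) := [set x | exists p (pf : ~ p f),
  pi p = x /\ V (contraction Gf pf)].
have WP p : W (pi p) <-> exists pf : ~ p f, V (contraction Gf pf).
  split=> [[q [qf [E h]]]|[pf h]]; last by exists p, pf.
  have pf : ~ p f.
    by move=> pf; apply: (qf); apply/((quotient_pi_eq G q p).1 E f (ex_intro _ e Gf)).
  by exists pf; rewrite -(contraction_pi Gf qf pf E).
(* Openness is tested on primes of [A]: on [D(a * f)] the contraction exists and avoids
   [a / f ^+ n]. *)
have oW : open W.
  rewrite /open /= /quotient_open; apply: basic_openP => p /WP [pf].
  move=> /(@zariski_basis _ (Opens oV)) [x [px xV]].
  have [n [a [Ga xE]]] := deg0_fracP x; exists (a * f); split.
    move=> /primeM [pa|//]; apply: px; rewrite xE; exact/(contraction_frac Gf pf Ga).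
  move=> r /primeM raf; have rf : ~ r f by move=> rf; apply: raf; right.
  apply/WP; exists rf; apply: xV; rewrite xE => /(contraction_frac Gf rf Ga) ra.
  by apply: raf; left.
exists (set_val @^-1` W); first by exists W.
apply/seteqP; split=> y /=; have [p [py pf]] := toQ_rep y.
  rewrite /preimage /= -[set_val (set_val y)]/(toQ y) -py => /WP [pf' h].
  by rewrite (chartE pf' (esym py)).
rewrite /preimage /= -[set_val (set_val y)]/(toQ y) -py (chartE pf (esym py)) => h.
by apply/WP; exists pf.
Qed.

(** A homogeneous [h] cutting out a neighbourhood has the same zeros on [D(f)] as some [b] of degree
    [e *+ m], and [b / f ^+ m] defines a basic open set of [Spec A_(f)]. *)
Lemma chart_open (W : opens (rs_top Y)) : open (chart @` W).
Proof.
apply: basic_openP => _ [y Wy <-]; have [p [py pf]] := toQ_rep y.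
have [h [[d Gh] ph hW]] := homogeneous_nbhd (lift2I Wy (esym py)).
have [m [b [Gb _ hb]]] := degree_zero_multiple Gf frel Gh.
exists (deg0_frac Gf Gb); rewrite (chartE pf (esym py)); split.
  by move=> /(contraction_frac Gf pf Gb) /(hb p pf).
move=> q; have [r [rf [z [<- zr zE]]]] := chart_surj q.
move=> rb; have rh : ~ r h.
  by move=> rh; apply: rb; apply/(contraction_frac Gf rf Gb)/(hb r rf).
have [z' [Wz' zz']] := lift2P (hW r rh); exists z' => //.
by rewrite (chartE rf zz').
Qed.

(** * Comparison of sections on the chart *)

Section Sections.
Variable V : opens (rs_top (Spec C)).

Let preV : opens (rs_top Q) := lift2 (opens_preim chart_continuous V).

Lemma preV_pf p : preV (pi p) -> ~ p f.
Proof.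
move=> /lift2P [y [_ yp]] pf; have [q [qy qf]] := toQ_rep y.
have E : pi q = pi p by rewrite qy.
by apply: qf; apply/((quotient_pi_eq G q p).1 E f (ex_intro _ e Gf)).
Qed.

Lemma preV_V p (pf : ~ p f) : preV (pi p) <-> V (contraction Gf pf).
Proof.
split=> [/lift2P [y [Vy yp]]|Vp]; first by rewrite -(chartE pf yp).
have [y yp] := toQ_lift pf; apply: (@lift2I _ _ y) => //.
by rewrite /= /preimage /= (chartE pf yp).
Qed.

Definition pull (s : spec_sec V) p (Op : preV (pi p)) : loc (prime_compl p) :=
  local_lift Gf (preV_pf Op) (s _ ((preV_V (preV_pf Op)).1 Op)).

Lemma pullE (s : spec_sec V) p (Op : preV (pi p)) (pf : ~ p f)
  (Vp : V (contraction Gf pf)) : pull s Op = local_lift Gf pf (s _ Vp).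
Proof.
rewrite /pull; move: ((preV_V (preV_pf Op)).1 Op).
by rewrite (Prop_irrelevance (preV_pf Op) pf) => h; rewrite (Prop_irrelevance h Vp).
Qed.

Lemma sharp_exists (s : spec_sec V) : exists t : rs_sec preV,
  forall p (Op : preV (pi p)), secval Op t = pull s Op.
Proof.
apply: homogeneous_section => p Op.
have pf := preV_pf Op; have Vp := (preV_V pf).1 Op.
have [W [hW [X [S [Wp eW]]]]] := secP s Vp.
have [K [pK KW]] := zariski_basis Wp; have [pS _] := eW _ Wp.
have [n [a [Ga XE]]] := deg0_fracP X; have [m [b [Gb SE]]] := deg0_fracP S.
have [l [k [Gk KE]]] := deg0_fracP K.
(* The fraction [X / S] becomes [a * f ^+ m] over [b * f ^+ n], both of the same degree. The extra
   factor [k * f] on both sides confines it to the points where [K] does not vanish and the formula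
   for [s] holds. *)
pose g := b * f ^+ n * (k * f).
exists (e *+ (n + m + (l + 1))), (a * f ^+ m * (k * f)), g.
have Gkf : G (e *+ (l + 1)) (k * f) by rewrite mulrnDr; exact: pieceM.
have rg r : ~ r g -> ~ r b /\ ~ r (k * f).
  by move=> rg; split=> h; apply: rg; apply/primeM; [left; apply/primeM; left|right].
split.
- rewrite !(mulrnDr _ (n + m)) (mulrnDr _ n).
  by apply: pieceM => //; apply: pieceM => //; exact: pieceX.
- rewrite [(n + m)%N]addnC !(mulrnDr _ (m + n)) (mulrnDr _ m).
  by apply: pieceM => //; apply: pieceM => //; exact: pieceX.
- move=> /primeM [/primeM [pb|/primeX //]|/primeM [pk|//]].
    by apply: pS; rewrite SE; exact/(contraction_frac Gf pf Gb).
  by apply: pK; rewrite KE; exact/(contraction_frac Gf pf Gk).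
move=> r Or /rg [rb rkf].
have rf : ~ r f by exact: preV_pf Or.
have Wr : W (contraction Gf rf).
  apply: KW; rewrite KE => /(contraction_frac Gf rf Gk) rk.
  by apply: rkf; apply/primeM; left.
rewrite (pullE s Or (hW _ Wr)); have [rS ->] := eW _ Wr.
have := local_lift_frac X rS; set y := local_lift _ _ _ => E.
have Ea := theta_frac Gf rf Ga; have Eb := theta_frac Gf rf Gb.
rewrite -XE in Ea; rewrite -SE in Eb.
rewrite /g !rmorphM /= -Ea -Eb -E; ring.
Qed.

Definition sharp (s : spec_sec V) : rs_sec preV := projT1 (cid (sharp_exists s)).

Lemma sharpE (s : spec_sec V) p (Op : preV (pi p)) (pf : ~ p f)
  (Vp : V (contraction Gf pf)) : secval Op (sharp s) = local_lift Gf pf (s _ Vp).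
Proof. by rewrite -(pullE s Op) /sharp; case: (cid _) => t /= ->. Qed.

Lemma sharp_zmod : zmod_morphism sharp.
Proof.
move=> s t; apply: secval_eq => p Op.
have pf := preV_pf Op; have Vp := (preV_V pf).1 Op.
by rewrite rmorphB /= !(sharpE _ _ Vp) -rmorphB.
Qed.

Lemma sharp_monoid : monoid_morphism sharp.
Proof.
split=> [|s t]; apply: secval_eq => p Op;
  have pf := preV_pf Op; have Vp := (preV_V pf).1 Op.
  by rewrite (sharpE _ _ Vp) !rmorph1.
by rewrite [RHS]rmorphM /= !(sharpE _ _ Vp) -rmorphM.
Qed.

HB.instance Definition _ :=
  GRing.isZmodMorphism.Build (spec_sec V) (rs_sec preV) sharp sharp_zmod.
HB.instance Definition _ :=
  GRing.isMonoidMorphism.Build (spec_sec V) (rs_sec preV) sharp sharp_monoid.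

Lemma sharp_inj : injective sharp.
Proof.
move=> s t E; apply: sec_eq => q Vq; have [p [pf [_ [pq _ _]]]] := chart_surj q.
subst q; apply: (@local_lift_inj _ _ _ _ _ Gf frel p pf).
have Op : preV (pi p) by apply/preV_V.
by rewrite -(sharpE s Op) -(sharpE t Op) E.
Qed.

(** Near each point [t] is a homogeneous fraction with denominator a power of [k * f], whose degree
    is a multiple of [e]; it is therefore a fraction over [A_(f)]. *)
Lemma sharp_surj (t : rs_sec preV) : exists s, sharp s = t.
Proof.
have local q : V q -> exists XS : C * C, ~ q XS.2 /\
    forall p (pf : ~ p f) (Op : preV (pi p)), ~ contraction Gf pf XS.2 ->
    theta Gf pf XS.2 * secval Op t = theta Gf pf XS.1.
  have [p0 [pf0 [_ [<- _ _]]]] := chart_surj q.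
  move=> /zariski_basis [K [pK KV]]; have [l [k [Gk KE]]] := deg0_fracP K.
  have pk : ~ p0 k.
    by move=> pk; apply: pK; rewrite KE; exact/(contraction_frac Gf pf0 Gk).
  have Gkf : G (e *+ (l + 1)) (k * f) by rewrite mulrnDr; exact: pieceM.
  have [|N [y [Gy hy]]] := section_homogeneous hA t Gkf.
    move=> r rkf; have rf : ~ r f by move=> rf; apply: rkf; apply/primeM; right.
    apply/(preV_V rf); apply: KV; rewrite KE => /(contraction_frac Gf rf Gk) rk.
    by apply: rkf; apply/primeM; left.
  (* The exponent [N.+1] makes the denominator vanish wherever [k * f] does, even if [N = 0]. *)
  have Gn : G (e *+ ((l + 1) * N.+1)) ((k * f) ^+ N.+1).
    by rewrite mulrnA; exact: pieceX.
  have Gy' : G (e *+ ((l + 1) * N.+1)) (k * f * y).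
    by rewrite mulrnA mulrS; exact: pieceM.
  exists (deg0_frac Gf Gy', deg0_frac Gf Gn); split=> /=.
    by move=> /(contraction_frac Gf pf0 Gn) /primeX /primeM [].
  move=> p pf Op pn; have pkf : ~ p (k * f).
    move=> pkf; apply: pn; apply/(contraction_frac Gf pf Gn).
    by rewrite exprS; apply/primeM; left.
  apply: (@loc_inj_cancel _ (prime_compl p) (f ^+ ((l + 1) * N.+1))).
    by move/primeX.
  rewrite mulrA (theta_frac Gf pf Gn) (theta_frac Gf pf Gy').
  by rewrite exprS !rmorphM /= -mulrA hy.
pose XS q (Vq : V q) := projT1 (cid (local q Vq)).
have XSP q (Vq : V q) := projT2 (cid (local q Vq)).
pose s0 q (Vq : V q) : loc (prime_compl q) :=
  @loc_frac _ (prime_compl q) (XS q Vq).1 _ (XSP q Vq).1.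
have s0E p (pf : ~ p f) (Vp : V (contraction Gf pf)) (Op : preV (pi p)) :
    local_lift Gf pf (s0 _ Vp) = secval Op t.
  have [qS h] := XSP _ Vp; apply: (loc_lift_cancel (@theta_unit _ _ _ _ _ Gf p pf) qS).
  by rewrite local_lift_frac h.
(* The fractions were chosen point by point. At nearby points they agree because [local_lift] is
   injective and sends both to the value of [t]. *)
have s0loc : locally_fraction s0.
  move=> q Vq; have [qS h] := XSP q Vq.
  have oW : open [set q : primeIdeal C | V q /\ ~ q (XS _ Vq).2].
    apply: (@openI _ V [set q : primeIdeal C | ~ q (XS _ Vq).2]); first exact: opensP.
    apply: basic_openP => q' /= q'S; by exists (XS _ Vq).2.
  exists (Opens oW), (fun q h => proj1 h), (XS _ Vq).1, (XS _ Vq).2.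
  split=> // q' [Vq' q'S].
  exists q'S; have [p [pf [_ [pq _ _]]]] := chart_surj q'; subst q'.
  apply: (@local_lift_inj _ _ _ _ _ Gf frel p pf).
  have Op : preV (pi p) by apply/preV_V.
  rewrite (s0E _ _ _ Op); apply: (loc_lift_cancel (@theta_unit _ _ _ _ _ Gf p pf) q'S).
  by rewrite local_lift_frac h.
exists (SpecSec s0loc); apply: secval_eq => p Op.
have pf := preV_pf Op; have Vp := (preV_V pf).1 Op.
by rewrite (sharpE _ _ Vp) /= s0E.
Qed.

Lemma sharp_bij : bijective sharp.
Proof. exact: inj_surj_bijective sharp_inj sharp_surj. Qed.

End Sections.

Let chart_sharp (V : opens (rs_top (Spec C))) :
  {rmorphism rs_sec V -> @rs_sec Y (opens_preim chart_continuous V)} := @sharp V.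

Lemma chart_sharp_nat (V W : opens (rs_top (Spec C))) (h : opens_sub W V)
    (k : opens_sub (opens_preim chart_continuous W)
                   (opens_preim chart_continuous V)) s :
  chart_sharp W (rs_res h s) = @rs_res Y _ _ k (chart_sharp V s).
Proof.
apply: secval_eq => p Op; have pf := preV_pf Op; have Wp := (preV_V W pf).1 Op.
have Vp := h _ Wp; have OV := (preV_V V pf).2 Vp.
rewrite [RHS](secval_res _ OV) [LHS](sharpE _ _ Wp) [RHS](sharpE _ _ Vp) /=.
by congr (local_lift _ _ (s _ _)); exact: Prop_irrelevance.
Qed.

Definition chart_mor : rsMor Y (Spec C) :=
  @RsMor Y (Spec C) chart chart_continuous chart_sharp chart_sharp_nat.

Lemma chart_isomorphic : rs_isomorphic Y (Spec C).
Proof.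
exists chart_mor; split; first exact: chart_bij.
  exact: chart_open.
exact: sharp_bij.
Qed.

End AffineChart.

Theorem proposition1p17 (D : zmodType) (A : comPzRingType) (G : grading D A)
    (D_fg : finitely_generated D) (A_noetherian : noetherian A)
    (A_normal : normal_ring A) :
  normal_scheme (Proj_MH G).
Proof.
split=> x; last first.
  have [p px] := quotient_pi_surj (set_val x).
  exact: (@stalk_normal _ _ G (Opens (Proj_set_open G)) A_normal x p px).
(* A relevant [f] with [x] in its basic open set provides the chart [Spec A_(f)] around [x]. *)
have [f frel fx] : Proj_set (G:=G) (set_val x) by case: x => x hx; exact: set_mem hx.
have [[e Gf] _] := frel.
have oU : open (set_val @^-1` D_plus (G:=G) f : set (rs_top (Proj_MH G))).
  by exists (D_plus (G:=G) f) => //; apply: D_plus_open; exists e.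
exists (Opens oU); split=> //; exists (deg0 Gf).
by apply: chart_isomorphic => // y hy; exists f.
Qed.
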